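(* Suppose that Assumptions 1 and 2 (stated in the context) hold true. Then the following statements hold. (I) Given any $\theta>0$, there exists a unique pair $(\alpha_\star(\theta),\beta_\star(\theta))$ of real numbers (with $\alpha_\star(\theta)<\beta_\star(\theta)$, so that $\Lambda(\alpha_\star(\theta),\beta_\star(\theta),\theta)$ is defined) such that $$\alpha_\star(\theta)<\bar\alpha_-(\theta),\qquad \bar\beta_+(\theta)<\beta_\star(\theta)$$ and $$\lambda_\star(\theta):=\Lambda\bigl(\alpha_\star(\theta),\beta_\star(\theta),\theta\bigr)=H_-\bigl(\alpha_\star(\theta),\theta\bigr)=H_+\bigl(\beta_\star(\theta),\theta\bigr).$$ (II) Given any $\theta>0$, the function $w(\cdot,\theta):\mathbb{R}\to\mathbb{R}$ that is defined, modulo an additive constant, by $$w_x(x,\theta)=\begin{cases}-k_+(x), & \text{if } x\le\alpha_\star(\theta),\\[2pt] \dfrac1\theta\dfrac{\mathrm{d}}{\mathrm{d}x}\ln\bigl(\phi_{\alpha_\star(\theta),\beta_\star(\theta),\theta}(x)\bigr), & \text{if } \alpha_\star(\theta)<x<\beta_\star(\theta),\\[2pt] k_-(x), & \text{if } x\ge\beta_\star(\theta),\end{cases}$$ is $C^2$. Furthermore, $w(\cdot,\theta)$ and $\lambda_\star(\theta)$ provide a solution to the HJB equation $$\min\Bigl\{\tfrac12\sigma^2(x)w_{xx}(x,\theta)+\tfrac12\theta\bigl(\sigma(x)w_x(x,\theta)\bigr)^2+b(x)w_x(x,\theta)+h(x)-\lambda_\star(\theta),\ \ k_+(x)+w_x(x,\theta),\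 \ k_-(x)-w_x(x,\theta)\Bigr\}=0,$$ that is, this identity holds true for all $x\in\mathbb{R}$.
   Context: Data: functions $b,\sigma,h,k_+,k_-:\mathbb{R}\to\mathbb{R}$. Assumption 1. The functions $b,\sigma$ are $C^1$ and there exists a constant $C>0$ such that $0<\sigma^2(x)<C$ for all $x\in\mathbb{R}$. Assumption 2. The function $h$ is $C^1$ and $h\ge 0$, the functions $k_+$ and $k_-$ are $C^2$, and there is a constant $K>0$ such that $0<k_+(x)<K$ and $0<k_-(x)<K$ for all $x\in\mathbb{R}$. Furthermore, if for $x\in\mathbb{R}$ and $\theta>0$ we define $$H_-(x,\theta)=\tfrac12\theta\sigma^2(x)k_+^2(x)-\tfrac12\sigma^2(x)k_+'(x)-b(x)k_+(x)+h(x),$$ $$H_+(x,\theta)=\tfrac12\theta\sigma^2(x)k_-^2(x)+\tfrac12\sigma^2(x)k_-'(x)+b(x)k_-(x)+h(x),$$ then, for all $\theta>0$: - $\lim_{x\downarrow-\infty}H_-(x,\theta)=\lim_{x\uparrow\infty}H_+(x,\theta)=\infty$; - there exist points $\bar\alpha_-(\theta)\le\bar\alpha_+(\theta)$ such that $H_-(\cdot,\theta)$ is strictly decreasing and positive in $(-\infty,\bar\alpha_-(\theta))$, strictly negative in $(\bar\alpha_-(\theta),\bar\alpha_+(\theta))$ if $\bar\alpha_-(\theta)<\bar\alpha_+(\theta)$, and strictly increasing and positive in $(\bar\alpha_+(\theta),\infty)$; - there exist points $\bar\beta_-(\theta)\le\bar\beta_+(\theta)$ such that $H_+(\cdot,\theta)$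 is strictly decreasing and positive in $(-\infty,\bar\beta_-(\theta))$, strictly negative in $(\bar\beta_-(\theta),\bar\beta_+(\theta))$ if $\bar\beta_-(\theta)<\bar\beta_+(\theta)$, and strictly increasing and positive in $(\bar\beta_+(\theta),\infty)$. Sturm-Liouville problem. Let $q(x)=\exp\bigl(\int_0^x\frac{2b(y)}{\sigma^2(y)}\,\mathrm{d}y\bigr)$. For $\alpha<\beta$ and $\theta>0$, consider the regular Sturm-Liouville eigenvalue problem on $[\alpha,\beta]$ with eigenvalue parameter $\lambda$, $$\bigl(q(x)u'(x)\bigr)'+\frac{2\theta}{\sigma^2(x)}\bigl(h(x)-\lambda\bigr)q(x)u(x)=0,$$ $$\theta k_+(\alpha)u(\alpha)+u'(\alpha)=0,\qquad \theta k_-(\beta)u(\beta)-u'(\beta)=0.$$ Its eigenvalues are real and simple and form a sequence $\lambda_0(\theta)>\lambda_1(\theta)>\cdots$ decreasing to $-\infty$; the eigenfunction for $\lambda_n(\theta)$ has exactly $n$ zeros in $(\alpha,\beta)$. Denote by $\Lambda(\alpha,\beta,\theta)$ the maximal eigenvalue $\lambda_0(\theta)$ and by $\phi_{\alpha,\beta,\theta}>0$ the corresponding eigenfunction normalised so that $\int_\alpha^\beta\frac{2\theta q(y)}{\sigma^2(y)}\phi_{\alpha,\beta,\theta}^2(y)\,\mathrm{d}y=1$. Equivalently, $$\Lambda(\alpha,\beta,\theta)=\theta\bigl(q(\alpha)k_+(\alpha)\phi_{\alpha,\beta,\theta}^2(\alpha)+q(\beta)k_-(\beta)\phi_{\alpha,\beta,\theta}^2(\beta)\bigr)+\int_\alpha^\beta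 q(y)\Bigl(\frac{2\theta h(y)}{\sigma^2(y)}\phi_{\alpha,\beta,\theta}^2(y)-\bigl(\phi_{\alpha,\beta,\theta}'(y)\bigr)^2\Bigr)\,\mathrm{d}y.$$ *)

(* Defs.v *)
From Stdlib Require Export Reals.
From Coquelicot Require Export Coquelicot.
Open Scope R_scope.

Definition class_C (n : nat) (f : R -> R) : Prop :=
  forall (k : nat) (x : R), (k <= n)%nat ->
    ex_derive_n f k x /\ continuous (Derive_n f k) x.

Definition Assumption1 (b sigma : R -> R) : Prop :=
  class_C 1 b /\ class_C 1 sigma /\
  exists C : R, 0 < C /\ forall x : R, 0 < sigma x ^ 2 < C.

Definition H_minus (b sigma h kp : R -> R) (theta x : R) : R :=
  1 / 2 * theta * sigma x ^ 2 * kp x ^ 2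
  - 1 / 2 * sigma x ^ 2 * Derive kp x - b x * kp x + h x.

Definition H_plus (b sigma h km : R -> R) (theta x : R) : R :=
  1 / 2 * theta * sigma x ^ 2 * km x ^ 2
  + 1 / 2 * sigma x ^ 2 * Derive km x + b x * km x + h x.

(* When [l = r] the clause on the middle interval is vacuous. *)
Definition valley (H : R -> R) (l r : R) : Prop :=
  l <= r /\
  (forall x y : R, x < y -> y < l -> H y < H x) /\
  (forall x : R, x < l -> 0 < H x) /\
  (forall x : R, l < x < r -> H x < 0) /\
  (forall x y : R, r < x -> x < y -> H x < H y) /\
  (forall x : R, r < x -> 0 < H x).

(* [am], [ap], [bm], [bp] give the turning points
   alpha-bar_-, alpha-bar_+, beta-bar_-, beta-bar_+ as functions of theta. *)
Definition Assumption2 (b sigma h kp km am ap bm bp : R -> R) : Prop :=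
  class_C 1 h /\ (forall x : R, 0 <= h x) /\
  class_C 2 kp /\ class_C 2 km /\
  (exists K : R, 0 < K /\
     (forall x : R, 0 < kp x < K) /\ (forall x : R, 0 < km x < K)) /\
  forall theta : R, 0 < theta ->
    is_lim (H_minus b sigma h kp theta) m_infty p_infty /\
    is_lim (H_plus b sigma h km theta) p_infty p_infty /\
    valley (H_minus b sigma h kp theta) (am theta) (ap theta) /\
    valley (H_plus b sigma h km theta) (bm theta) (bp theta).

Definition q (b sigma : R -> R) (x : R) : R :=
  exp (RInt (fun y => 2 * b y / sigma y ^ 2) 0 x).

(* [D_in] is the derivative relative to a domain, so the derivatives at alpha
   and beta are one-sided and the values of [u] off [alpha, beta] play no
   role. [u'] and [qu''] stand for u' and (q u')' on [alpha, beta]. *)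
Definition is_eigenfunction (b sigma h kp km : R -> R)
    (alpha beta theta lambda : R) (u : R -> R) : Prop :=
  let I := fun x : R => alpha <= x <= beta in
  (exists x : R, I x /\ u x <> 0) /\
  exists u' qu'' : R -> R,
    (forall x : R, I x ->
       D_in u u' I x /\
       D_in (fun y => q b sigma y * u' y) qu'' I x /\
       qu'' x
       + 2 * theta / sigma x ^ 2 * (h x - lambda) * q b sigma x * u x = 0) /\
    theta * kp alpha * u alpha + u' alpha = 0 /\
    theta * km beta * u beta - u' beta = 0.

Definition is_eigenvalue (b sigma h kp km : R -> R)
    (alpha beta theta lambda : R) : Prop :=
  exists u : R -> R,
    is_eigenfunction b sigma h kp km alpha beta theta lambda u.

(* Lambda(alpha, beta, theta) = lambda *)
Definition is_Lambda (b sigma h kp km : R -> R)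
    (alpha beta theta lambda : R) : Prop :=
  is_eigenvalue b sigma h kp km alpha beta theta lambda /\
  forall mu : R,
    is_eigenvalue b sigma h kp km alpha beta theta mu -> mu <= lambda.

(* phi_{alpha, beta, theta} = phi on [alpha, beta] *)
Definition is_phi (b sigma h kp km : R -> R)
    (alpha beta theta : R) (phi : R -> R) : Prop :=
  (exists lambda : R,
     is_Lambda b sigma h kp km alpha beta theta lambda /\
     is_eigenfunction b sigma h kp km alpha beta theta lambda phi) /\
  (forall x : R, alpha <= x <= beta -> 0 < phi x) /\
  is_RInt (fun y => 2 * theta * q b sigma y / sigma y ^ 2 * phi y ^ 2)
    alpha beta 1.

(* (alpha, beta) = (alpha_star(theta), beta_star(theta)) is admissible, with
   lambda the corresponding value of lambda_star(theta). *)
Definition free_boundary (b sigma h kp km am bp : R -> R)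
    (theta alpha beta lambda : R) : Prop :=
  alpha < beta /\ alpha < am theta /\ bp theta < beta /\
  is_Lambda b sigma h kp km alpha beta theta lambda /\
  lambda = H_minus b sigma h kp theta alpha /\
  lambda = H_plus b sigma h km theta beta.

Definition w_x (kp km : R -> R) (theta alpha beta : R) (phi : R -> R)
    (x : R) : R :=
  if Rle_dec x alpha then - kp x
  else if Rlt_dec x beta then 1 / theta * Derive (fun y => ln (phi y)) x
  else km x.

Definition HJB (b sigma h kp km : R -> R) (theta : R)
    (w : R -> R) (lambda : R) : Prop :=
  forall x : R,
    Rmin (1 / 2 * sigma x ^ 2 * Derive_n w 2 x
          + 1 / 2 * theta * (sigma x * Derive w x) ^ 2
          + b x * Derive w x + h x - lambda)
      (Rmin (kp x + Derive w x) (km x - Derive w x)) = 0.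

(* Main.v *)
Require Import Defs.
From Stdlib Require Import Lra Lia Psatz Classical.

(* With g = w_x and P = q u', u = exp(theta w), the HJB equation is a Riccati equation
   for g whose linearisation is the Sturm-Liouville system u' = P / q,
   P' = (2 theta q / sigma^2) (lambda - h) u.  Since H_- (resp. H_+) is the level
   lambda at which -k_+ (resp. k_-) solves this Riccati equation, -k_+ and k_- are sub- or
   supersolutions according to the sign of lambda - H_-, lambda - H_+.  Existence of
   (alpha, beta, lambda) follows by shooting in lambda; the barriers also give uniqueness
   and the bounds -k_+ <= g <= k_-, and Picone's identity shows that an eigenvalue with a
   positive eigenfunction is maximal.  The conditions lambda = H_-(alpha) = H_+(beta) say
   that g has the derivatives of -k_+ and k_- at alpha and beta. *)

(** The obstacle is that alpha and beta move with the unknown level, so shooting has no fixed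
    interval to work on. It is removed by letting the level depend on x: outside a pair x0 <= y0 it
    follows H_- and H_+ wherever these exceed lambda. There -k_+ and k_- are exact solutions, which
    carry the boundary conditions inwards to the points where H_- and H_+ equal lambda. The shooting
    range is bounded above by a level dominating the Riccati level of an affine barrier, and below
    by a base level that no solution attains. Excluding the base level is what makes alpha < am, bp
    < beta and alpha < beta strict, whatever the relative position of the two valleys. Spectral
    theory enters only through positivity: shooting yields a positive eigenfunction on every compact
    interval, and maximality identifies its eigenvalue with Lambda. The linear system is preferred
    to the Riccati equation because its solutions exist globally and depend on lambda in a Lipschitz
    way, while g blows up at the zeros of u. *)

Ltac derive_rw H :=
  match type of H with
  | is_derive ?f ?x ?d =>
      replace (Derive (fun t => f t) x) with d
        by (symmetry; exact (is_derive_unique f x d H))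
  end.

Lemma is_derive_cont (f : R -> R) (x d : R) : is_derive f x d -> continuous f x.
Proof. intros H. apply (ex_derive_continuous f x). now exists d. Qed.

Lemma is_derive_cont_pt (f : R -> R) (x d : R) : is_derive f x d -> continuity_pt f x.
Proof. intros H. apply continuity_pt_filterlim. now apply (is_derive_cont f x d). Qed.

Lemma is_derive_Rplus (f g : R -> R) (x a b : R) :
  is_derive f x a -> is_derive g x b -> is_derive (fun y => f y + g y) x (a + b).
Proof. exact (is_derive_plus f g x a b). Qed.

Lemma is_derive_Rminus (f g : R -> R) (x a b : R) :
  is_derive f x a -> is_derive g x b -> is_derive (fun y => f y - g y) x (a - b).
Proof. exact (is_derive_minus f g x a b). Qed.

Lemma is_derive_Rext (f g : R -> R) (x d : R) :
  (forall t, g t = f t) -> is_derive f x d -> is_derive g x d.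
Proof. intros E. apply (is_derive_ext f g). intros t. now rewrite E. Qed.

Lemma is_derive_shift (f : R -> R) (k x a : R) :
  is_derive f x a -> is_derive (fun y => k + f y) x a.
Proof.
  intros H. rewrite <- (Rplus_0_l a).
  apply (is_derive_Rplus (fun _ => k)); [apply is_derive_Reals, derivable_pt_lim_const|easy].
Qed.

Lemma RInt_point0 (f : R -> R) (a : R) : RInt f a a = 0.
Proof. exact (RInt_point (V := R_CompleteNormedModule) a f). Qed.

Lemma continuous_Rplus (f g : R -> R) (x : R) :
  continuous f x -> continuous g x -> continuous (fun y => f y + g y) x.
Proof. exact (continuous_plus f g x). Qed.

Lemma continuous_Rminus (f g : R -> R) (x : R) :
  continuous f x -> continuous g x -> continuous (fun y => f y - g y) x.
Proof. exact (continuous_minus f g x). Qed.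

Lemma continuous_Ropp (f : R -> R) (x : R) :
  continuous f x -> continuous (fun y => - f y) x.
Proof. exact (continuous_opp f x). Qed.

Lemma continuous_Rmult (f g : R -> R) (x : R) :
  continuous f x -> continuous g x -> continuous (fun y => f y * g y) x.
Proof. exact (continuous_mult f g x). Qed.

Lemma continuous_Rpow2 (f : R -> R) (x : R) :
  continuous f x -> continuous (fun y => f y ^ 2) x.
Proof.
  intros H. apply (continuous_ext (fun y => f y * f y)); [intros; simpl; ring|].
  now apply continuous_Rmult.
Qed.

Lemma continuous_Rdiv (f g : R -> R) (x : R) :
  continuous f x -> continuous g x -> g x <> 0 -> continuous (fun y => f y / g y) x.
Proof.
  intros Hf Hg Hn. apply (continuous_mult f (fun y => / g y)); [easy|].
  now apply (continuous_comp g Rinv); [|apply continuous_Rinv].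
Qed.

(** Quotients leave the nonvanishing of the denominator to the caller. *)
Ltac cont :=
  cbv beta;
  lazymatch goal with
  | |- continuous (fun _ => ?k) _ => apply continuous_const
  | |- continuous (fun y => y) _ => apply continuous_id
  | |- continuous (fun y => @?f y + @?g y) _ => apply (continuous_Rplus f g); cont
  | |- continuous (fun y => @?f y - @?g y) _ => apply (continuous_Rminus f g); cont
  | |- continuous (fun y => - @?f y) _ => apply (continuous_Ropp f); cont
  | |- continuous (fun y => @?f y * @?g y) _ => apply (continuous_Rmult f g); cont
  | |- continuous (fun y => @?f y ^ 2) _ => apply (continuous_Rpow2 f); cont
  | |- continuous (fun y => @?f y / @?g y) _ => apply (continuous_Rdiv f g); [cont|cont|]
  | |- _ => try solve [trivial | match goal with H : forall _, continuous _ _ |- _ => exact (H _) end]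
  end.

Lemma mono_le (f df : R -> R) (a b : R) :
  a <= b ->
  (forall x, a <= x <= b -> is_derive f x (df x)) ->
  (forall x, a <= x <= b -> 0 <= df x) -> f a <= f b.
Proof.
  intros ab Hd Hp.
  destruct (MVT_gen f a b df) as [c [Hc E]];
    rewrite ?Rmin_left, ?Rmax_right in * by easy.
  - intros x Hx. apply Hd; lra.
  - intros x Hx. apply (is_derive_cont_pt f x (df x)), Hd; lra.
  - specialize (Hp c Hc). nra.
Qed.

Lemma is_derive_pos_right (f : R -> R) (x b d : R) :
  is_derive f x d -> 0 < d -> x < b -> exists y, x < y < b /\ f x < f y.
Proof.
  intros Hd Hp xb. apply is_derive_Reals in Hd.
  destruct (Hd (d / 2)) as [e He]; [lra|].
  set (h := Rmin (e / 2) ((b - x) / 2)).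
  assert (0 < e) by apply cond_pos.
  assert (Hh : 0 < h) by (apply Rmin_glb_lt; lra).
  assert (h <= e / 2) by apply Rmin_l.
  assert (h <= (b - x) / 2) by apply Rmin_r.
  exists (x + h). split; [lra|].
  specialize (He h). rewrite (Rabs_pos_eq h) in He by lra.
  assert (He' := He ltac:(lra) ltac:(lra)).
  apply Rabs_def2 in He'.
  assert (0 < (f (x + h) - f x) / h) by lra.
  apply (Rmult_lt_compat_r h) in H2; [|easy].
  field_simplify in H2; lra.
Qed.

Lemma is_derive_pos_left (f : R -> R) (a x d : R) :
  is_derive f x d -> 0 < d -> a < x -> exists y, a < y < x /\ f y < f x.
Proof.
  intros Hd Hp ax.
  destruct (is_derive_pos_right (fun t => - f (- t)) (- x) (- a) d) as [y [Hy E]].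
  - auto_derive; rewrite Ropp_involutive.
    + now exists d.
    + derive_rw Hd. ring.
  - easy.
  - lra.
  - rewrite Ropp_involutive in E. exists (- y). lra.
Qed.

(** One point of positive derivative gives strictness without continuity of [df]: [f] increases
    strictly on one side of [x0], to the right if [x0 < b] and otherwise to the left. *)
Lemma mono_lt (f df : R -> R) (a b x0 : R) :
  a < b ->
  (forall x, a <= x <= b -> is_derive f x (df x)) ->
  (forall x, a <= x <= b -> 0 <= df x) ->
  a <= x0 <= b -> 0 < df x0 -> f a < f b.
Proof.
  intros ab Hd Hp Hx0 Hpos.
  assert (M : forall u v, a <= u -> u <= v -> v <= b -> f u <= f v).
  { intros u v au uv vb. apply (mono_le f df); [easy| |]; intros x Hx;
      [apply Hd|apply Hp]; lra. }
  destruct (Rlt_dec x0 b) as [Hb|Hb].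
  - destruct (is_derive_pos_right f x0 b (df x0)) as [y [Hy E]]; auto.
    assert (f a <= f x0) by (apply M; lra).
    assert (f y <= f b) by (apply M; lra). lra.
  - destruct (is_derive_pos_left f a x0 (df x0)) as [y [Hy E]]; auto; [lra|].
    assert (f x0 <= f b) by (apply M; lra).
    assert (f a <= f y) by (apply M; lra). lra.
Qed.

Lemma continuous_bounded (f : R -> R) (a b : R) :
  (forall x, a <= x <= b -> continuous f x) ->
  exists M, 0 < M /\ forall x, a <= x <= b -> Rabs (f x) <= M.
Proof.
  intros Hc. destruct (Rle_dec a b) as [ab|ab].
  - destruct (continuity_ab_maj (fun x => Rabs (f x)) a b ab) as [m [Hm _]].
    { intros c Hcb. apply continuity_pt_filterlim.
      apply (continuous_Rabs_comp f). now apply Hc. }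
    exists (Rabs (f m) + 1). split.
    + assert (H := Rabs_pos (f m)). lra.
    + intros x Hx. specialize (Hm x Hx). simpl in Hm. lra.
  - exists 1. split; [lra|]. intros; lra.
Qed.

Lemma is_derive_RInt_cont (f : R -> R) (a x : R) :
  (forall t, continuous f t) -> is_derive (fun y => RInt f a y) x (f x).
Proof.
  intros Hc. apply (is_derive_RInt f _ a).
  - apply filter_forall. intros y. apply (RInt_correct (V := R_CompleteNormedModule) f).
    apply (ex_RInt_continuous f). intros; apply Hc.
  - apply Hc.
Qed.

(** * Linear first order systems *)

Definition sol (r c : R -> R) (a b : R) (U P : R -> R) : Prop :=
  forall x, a <= x <= b ->
    is_derive U x (r x * P x) /\ is_derive P x (c x * U x).

Lemma sol_sub (r c : R -> R) (a b a' b' : R) (U P : R -> R) :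
  a <= a' -> b' <= b -> sol r c a b U P -> sol r c a' b' U P.
Proof. intros H1 H2 S x Hx. apply S; lra. Qed.

(** Integrating the weight exp(2M|t - L|) from L gains a factor 1/(2M). With coefficients bounded by
    M, this makes the Picard map a contraction with ratio 1/2 on the whole line. *)
Lemma RInt_exp_weight_bound (f : R -> R) (K M L x : R) :
  0 < M -> (forall t, continuous f t) ->
  (forall t, Rabs (f t) <= K * exp (2 * M * Rabs (t - L))) ->
  Rabs (RInt f L x) <= K / (2 * M) * exp (2 * M * Rabs (x - L)).
Proof.
  intros HM Hc Hb.
  assert (F0 : RInt f L L = 0) by apply RInt_point0.
  assert (HK : 0 <= K).
  { specialize (Hb L). replace (L - L) with 0 in Hb by ring.
    rewrite Rabs_R0, Rmult_0_r, exp_0 in Hb. assert (H := Rabs_pos (f L)). lra. }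
  assert (K2 : 0 <= K / (2 * M)) by (apply Rdiv_le_0_compat; lra).
  assert (HF : forall t, is_derive (fun y => RInt f L y) t (f t))
    by (intros; now apply is_derive_RInt_cont).
  set (F := fun y => RInt f L y) in *.
  change (RInt f L x) with (F x). change (F L = 0) in F0.
  destruct (Rle_dec L x) as [Hx|Hx].
  - set (phi := fun y => K / (2 * M) * exp (2 * M * (y - L))).
    assert (Hphi : forall y, is_derive phi y (K * exp (2 * M * (y - L)))).
    { intros y. unfold phi. auto_derive; [easy|]. unfold Rminus. field. lra. }
    assert (Hb' : forall y, L <= y <= x -> Rabs (f y) <= K * exp (2 * M * (y - L))).
    { intros y Hy. specialize (Hb y). now rewrite (Rabs_pos_eq (y - L)) in Hb by lra. }
    rewrite (Rabs_pos_eq (x - L)) by lra. fold (phi x).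
    assert (phL : phi L = K / (2 * M)).
    { unfold phi. replace (L - L) with 0 by ring. now rewrite Rmult_0_r, exp_0, Rmult_1_r. }
    assert (H1 : phi L - F L <= phi x - F x).
    { apply (mono_le (fun y => phi y - F y)
               (fun y => K * exp (2 * M * (y - L)) - f y)); [easy| |].
      - intros y _. apply is_derive_Rminus; auto.
      - intros y Hy. specialize (Hb' y Hy). apply Rabs_le_between in Hb'. lra. }
    assert (H2 : phi L + F L <= phi x + F x).
    { apply (mono_le (fun y => phi y + F y)
               (fun y => K * exp (2 * M * (y - L)) + f y)); [easy| |].
      - intros y _. apply is_derive_Rplus; auto.
      - intros y Hy. specialize (Hb' y Hy). apply Rabs_le_between in Hb'. lra. }
    apply Rabs_le_between. lra.
  (* Left of [L] the weight decreases in y, so its antiderivative carries a minus sign and the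
     comparison runs from [x] up to [L]. *)
  - set (phi := fun y => - (K / (2 * M) * exp (2 * M * (L - y)))).
    assert (Hphi : forall y, is_derive phi y (K * exp (2 * M * (L - y)))).
    { intros y. unfold phi. auto_derive; [easy|]. unfold Rminus. field. lra. }
    assert (Hb' : forall y, x <= y <= L -> Rabs (f y) <= K * exp (2 * M * (L - y))).
    { intros y Hy. specialize (Hb y). rewrite Rabs_minus_sym in Hb.
      now rewrite (Rabs_pos_eq (L - y)) in Hb by lra. }
    rewrite Rabs_minus_sym, (Rabs_pos_eq (L - x)) by lra.
    assert (phx : K / (2 * M) * exp (2 * M * (L - x)) = - phi x) by (unfold phi; ring).
    rewrite phx.
    assert (phL : phi L = - (K / (2 * M))).
    { unfold phi. replace (L - L) with 0 by ring. rewrite Rmult_0_r, exp_0. ring. }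
    assert (H1 : phi x - F x <= phi L - F L).
    { apply (mono_le (fun y => phi y - F y)
               (fun y => K * exp (2 * M * (L - y)) - f y)); [lra| |].
      - intros y _. apply is_derive_Rminus; auto.
      - intros y Hy. specialize (Hb' y Hy). apply Rabs_le_between in Hb'. lra. }
    assert (H2 : phi x + F x <= phi L + F L).
    { apply (mono_le (fun y => phi y + F y)
               (fun y => K * exp (2 * M * (L - y)) + f y)); [lra| |].
      - intros y _. apply is_derive_Rplus; auto.
      - intros y Hy. specialize (Hb' y Hy). apply Rabs_le_between in Hb'. lra. }
    apply Rabs_le_between. lra.
Qed.

Lemma pow_half_small (C eps : R) :
  0 < eps -> exists N, forall n, (N <= n)%nat -> C * (/ 2) ^ n < eps.
Proof.
  intros He. assert (HC := Rabs_pos C).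
  destruct (proj1 (is_lim_seq_Reals _ _)
    (is_lim_seq_geom (/ 2) ltac:(rewrite Rabs_pos_eq; lra)) (eps / (Rabs C + 1)))
    as [N HN].
  { apply Rdiv_lt_0_compat; lra. }
  exists N. intros n Hn. specialize (HN n Hn). unfold Rdist in HN.
  rewrite Rminus_0_r in HN.
  assert (Hp : 0 < (/ 2) ^ n) by (apply pow_lt; lra).
  rewrite Rabs_pos_eq in HN by lra.
  apply (Rmult_lt_compat_r (Rabs C + 1)) in HN; [|lra].
  unfold Rdiv in HN. rewrite Rmult_assoc, Rinv_l, Rmult_1_r in HN by lra.
  assert (C <= Rabs C) by apply Rle_abs. nra.
Qed.

Lemma Lim_seq_geom_bound (a : nat -> R) (K : R) :
  (forall n, Rabs (a (S n) - a n) <= K * (/ 2) ^ n) ->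
  forall n, Rabs (real (Lim_seq a) - a n) <= 2 * K * (/ 2) ^ n.
Proof.
  intros H.
  (* The exact tail of the geometric series is kept, since the weaker bound by [2 * K * (/ 2) ^ n]
     would not survive the induction on [k]. *)
  assert (T : forall n k, Rabs (a (n + k)%nat - a n) <= 2 * K * ((/ 2) ^ n - (/ 2) ^ (n + k))).
  { intros n k. induction k as [|k IH].
    - rewrite Nat.add_0_r. unfold Rminus at 1. rewrite Rplus_opp_r, Rabs_R0. lra.
    - rewrite <- plus_n_Sm. specialize (H (n + k)%nat).
      replace (a (S (n + k)) - a n)
        with ((a (S (n + k)) - a (n + k)%nat) + (a (n + k)%nat - a n)) by ring.
      eapply Rle_trans; [apply Rabs_triang|]. simpl pow. lra. }
  assert (HK : 0 <= K).
  { specialize (H 0%nat). simpl in H. assert (X := Rabs_pos (a 1%nat - a 0%nat)). lra. }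
  assert (T' : forall n m, (n <= m)%nat -> Rabs (a m - a n) <= 2 * K * (/ 2) ^ n).
  { intros n m Hm. specialize (T n (m - n)%nat).
    replace (n + (m - n))%nat with m in T by lia.
    assert (Hp : 0 < (/ 2) ^ m) by (apply pow_lt; lra). nra. }
  assert (E : ex_finite_lim_seq a).
  { apply ex_lim_seq_cauchy_corr. intros eps.
    destruct (pow_half_small (4 * K) eps (cond_pos eps)) as [N HN].
    specialize (HN N (le_n _)). exists N. intros n m Hn Hm.
    replace (a n - a m) with ((a n - a N) - (a m - a N)) by ring.
    eapply Rle_lt_trans; [apply Rabs_triang|]. rewrite Rabs_Ropp.
    assert (X := T' N n Hn). assert (Y := T' N m Hm). lra. }
  apply Lim_seq_correct' in E. intros n.
  assert (E' : is_lim_seq (fun m => Rabs (a m - a n)) (Rabs (real (Lim_seq a) - a n))).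
  { apply (is_lim_seq_abs _ (Finite (real (Lim_seq a) - a n))). apply is_lim_seq_minus'; [easy|].
    apply is_lim_seq_const. }
  refine (is_lim_seq_le_loc _ (fun _ => 2 * K * (/ 2) ^ n) (Finite _) (Finite _)
            _ E' (is_lim_seq_const _)).
  exists n. intros m Hm. now apply T'.
Qed.

(** * Picard iteration in an exponentially weighted norm *)

Section Picard.
Variables (r c : R -> R) (M L u0 p0 : R).
Hypothesis HM : 0 < M.
Hypothesis r_cont : forall x, continuous r x.
Hypothesis c_cont : forall x, continuous c x.
Hypothesis r_bound : forall x, Rabs (r x) <= M.
Hypothesis c_bound : forall x, Rabs (c x) <= M.

Fixpoint picard (n : nat) : (R -> R) * (R -> R) :=
  match n with
  | O => (fun _ => u0, fun _ => p0)
  | S n => (fun x => u0 + RInt (fun t => r t * snd (picard n) t) L x,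
            fun x => p0 + RInt (fun t => c t * fst (picard n) t) L x)
  end.

Let B := Rabs u0 + Rabs p0.
(** Bielecki weight: distances are measured as multiples of [e], and [B] bounds the initial data. *)
Let e x := exp (2 * M * Rabs (x - L)).

Lemma RInt_mult_cont (f g : R -> R) (k x : R) :
  (forall t, continuous f t) -> (forall t, continuous g t) ->
  continuous (fun x => k + RInt (fun t => f t * g t) L x) x.
Proof.
  intros Hf Hg. apply (is_derive_cont _ x (f x * g x)).
  apply is_derive_shift.
  apply (is_derive_RInt_cont (fun t => f t * g t)).
  intros t. now apply (continuous_mult f g).
Qed.

Lemma picard_cont (n : nat) (x : R) :
  continuous (fst (picard n)) x /\ continuous (snd (picard n)) x.
Proof.
  revert x. induction n as [|n IH]; intros x; simpl.
  - split; apply continuous_const.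
  - split; apply RInt_mult_cont; auto; intros t; apply IH.
Qed.

(** The contraction step: the factor [M] from the coefficient against 1/(2M) from the weight leaves
    1/2. *)
Lemma RInt_mult_sub_bound (f g1 g2 : R -> R) (k K x : R) :
  (forall t, continuous f t) -> (forall t, Rabs (f t) <= M) ->
  (forall t, continuous g1 t) -> (forall t, continuous g2 t) ->
  (forall t, Rabs (g1 t - g2 t) <= K * e t) ->
  Rabs ((k + RInt (fun t => f t * g1 t) L x) - (k + RInt (fun t => f t * g2 t) L x))
    <= K / 2 * e x.
Proof.
  intros Hf Hb H1 H2 Hd.
  assert (X1 : ex_RInt (fun t => f t * g1 t) L x).
  { apply (ex_RInt_continuous (fun t => f t * g1 t)).
    intros; now apply (continuous_mult f g1). }
  assert (X2 : ex_RInt (fun t => f t * g2 t) L x).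
  { apply (ex_RInt_continuous (fun t => f t * g2 t)).
    intros; now apply (continuous_mult f g2). }
  replace ((k + RInt (fun t => f t * g1 t) L x) - (k + RInt (fun t => f t * g2 t) L x))
    with (RInt (fun t => f t * g1 t - f t * g2 t) L x).
  2:{ rewrite (RInt_minus (V := R_CompleteNormedModule)
                 (fun t => f t * g1 t) (fun t => f t * g2 t)) by easy.
      unfold minus, plus, opp; simpl. ring. }
  replace (K / 2) with (M * K / (2 * M)) by (field; lra).
  apply RInt_exp_weight_bound; [easy| |].
  - intros t. apply (continuous_minus (fun t => f t * g1 t) (fun t => f t * g2 t));
      [now apply (continuous_mult f g1)|now apply (continuous_mult f g2)].
  - intros t. replace (f t * g1 t - f t * g2 t) with (f t * (g1 t - g2 t)) by ring.
    rewrite Rabs_mult, Rmult_assoc. apply Rmult_le_compat; auto using Rabs_pos.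
Qed.

Lemma picard_step (n : nat) (x : R) :
  Rabs (fst (picard (S n)) x - fst (picard n) x) <= (B * e x) * (/ 2) ^ n /\
  Rabs (snd (picard (S n)) x - snd (picard n) x) <= (B * e x) * (/ 2) ^ n.
Proof.
  assert (Bp := Rabs_pos u0). assert (Bq := Rabs_pos p0).
  revert x. induction n as [|n IH]; intros x.
  - assert (Z : forall (k f0 : R) (f : R -> R),
      (forall t, continuous f t) -> (forall t, Rabs (f t) <= M) ->
      Rabs f0 <= B ->
      Rabs ((k + RInt (fun t => f t * f0) L x) - k) <= B * e x * (/ 2) ^ 0).
    { intros k f0 f Hf Hb H0.
      assert (Y := RInt_mult_sub_bound f (fun _ => f0) (fun _ => 0) k B x Hf Hb
        (fun _ => continuous_const _ _) (fun _ => continuous_const _ _)).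
      rewrite (RInt_ext (fun t => f t * 0) (fun _ => 0)) in Y
        by (intros; apply Rmult_0_r).
      rewrite RInt_const in Y. unfold scal in Y; simpl in Y.
      unfold mult in Y; simpl in Y. rewrite Rmult_0_r, Rplus_0_r in Y.
      assert (0 <= B * e x) by (apply Rmult_le_pos; [unfold B; lra|apply Rlt_le, exp_pos]).
      eapply Rle_trans; [apply Y|simpl; lra].
      intros t. rewrite Rminus_0_r.
      assert (1 <= e t).
      { rewrite <- exp_0. unfold e.
        assert (G := Rabs_pos (t - L)).
        destruct (Rle_lt_or_eq_dec _ _ G) as [G'|G'].
        - left. apply exp_increasing. nra.
        - rewrite <- G', Rmult_0_r. lra. }
      assert (0 <= Rabs f0) by apply Rabs_pos. nra. }
    split; simpl; apply Z; auto; unfold B; lra.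
  - simpl pow.
    replace (B * e x * (/ 2 * (/ 2) ^ n)) with ((B * (/ 2) ^ n) / 2 * e x) by field.
    change (picard (S (S n))) with
      (fun x => u0 + RInt (fun t => r t * snd (picard (S n)) t) L x,
       fun x => p0 + RInt (fun t => c t * fst (picard (S n)) t) L x).
    change (picard (S n)) with
      (fun x => u0 + RInt (fun t => r t * snd (picard n) t) L x,
       fun x => p0 + RInt (fun t => c t * fst (picard n) t) L x) at 2 4.
    split; apply RInt_mult_sub_bound; auto; try (intros; apply picard_cont);
      intros t; replace (B * (/ 2) ^ n * e t) with (B * e t * (/ 2) ^ n) by ring; apply IH.
Qed.

Let U x := real (Lim_seq (fun n => fst (picard n) x)).
Let P x := real (Lim_seq (fun n => snd (picard n) x)).

Lemma picard_lim (n : nat) (x : R) :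
  Rabs (U x - fst (picard n) x) <= 2 * (B * e x) * (/ 2) ^ n /\
  Rabs (P x - snd (picard n) x) <= 2 * (B * e x) * (/ 2) ^ n.
Proof.
  split.
  - apply (Lim_seq_geom_bound (fun n => fst (picard n) x)). intros; apply picard_step.
  - apply (Lim_seq_geom_bound (fun n => snd (picard n) x)). intros; apply picard_step.
Qed.

(** The weight is unbounded on the line, so convergence is uniform only locally; on the unit ball
    around [x] the weight is at most its value at distance |x - L| + 1. *)
Lemma CVU_geom_cont (f : nat -> R -> R) (F : R -> R) :
  (forall n x, continuous (f n) x) ->
  (forall n x, Rabs (F x - f n x) <= 2 * (B * e x) * (/ 2) ^ n) ->
  forall x, continuous F x.
Proof.
  intros Hc Hb x. apply continuity_pt_filterlim.
  apply (CVU_continuity f F x (mkposreal 1 Rlt_0_1)).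
  - intros eps He.
    destruct (pow_half_small (2 * (B * exp (2 * M * (Rabs (x - L) + 1)))) eps He) as [N HN].
    exists N. intros n y Hn Hy. eapply Rle_lt_trans; [apply Hb|].
    eapply Rle_lt_trans; [|apply (HN n Hn)].
    assert (0 < (/ 2) ^ n) by (apply pow_lt; lra).
    apply Rmult_le_compat_r; [lra|]. apply Rmult_le_compat_l; [lra|].
    apply Rmult_le_compat_l.
    { unfold B. assert (Bp := Rabs_pos u0). assert (Bq := Rabs_pos p0). lra. }
    unfold Boule in Hy; simpl in Hy.
    assert (Rabs (y - L) <= Rabs (x - L) + 1).
    { replace (y - L) with ((x - L) + (y - x)) by ring.
      eapply Rle_trans; [apply Rabs_triang|lra]. }
    unfold e.
    destruct (Req_dec (Rabs (y - L)) (Rabs (x - L) + 1)) as [->|]; [lra|].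
    left. apply exp_increasing. nra.
  - intros n y _. apply continuity_pt_filterlim, Hc.
  - unfold Boule; simpl. rewrite Rminus_diag, Rabs_R0. lra.
Qed.

Lemma eq_of_geometric_bound (a b C : R) :
  (forall n, Rabs (a - b) <= C * (/ 2) ^ n) -> a = b.
Proof.
  intros H. destruct (Req_dec a b) as [|E]; [easy|].
  assert (0 < Rabs (a - b)) by (apply Rabs_pos_lt; lra).
  destruct (pow_half_small C (Rabs (a - b))) as [N HN]; [easy|].
  specialize (HN N (le_n _)). specialize (H N). lra.
Qed.

(** The error of [F] in the integral equation is at most its distance to iterate n + 1 plus half the
    weighted distance of [G] to iterate n, and both are of order 2^-n. Separate [f] and [g] let one
    statement serve both components of the system. *)
Lemma integral_eq_of_picard (f : nat -> R -> R) (g : nat -> R -> R) (F G s : R -> R) (k : R) :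
  (forall t, continuous s t) -> (forall t, Rabs (s t) <= M) ->
  (forall n x, continuous (g n) x) -> (forall x, continuous G x) ->
  (forall n x, Rabs (F x - f n x) <= 2 * (B * e x) * (/ 2) ^ n) ->
  (forall n x, Rabs (G x - g n x) <= 2 * (B * e x) * (/ 2) ^ n) ->
  (forall n x, f (S n) x = k + RInt (fun t => s t * g n t) L x) ->
  forall x, F x = k + RInt (fun t => s t * G t) L x.
Proof.
  intros Hs Hsb Hg HG Hf Hgb Hrec x.
  apply (eq_of_geometric_bound _ _ (2 * (B * e x))). intros n.
  replace (F x - (k + RInt (fun t => s t * G t) L x))
    with ((F x - f (S n) x)
      - ((k + RInt (fun t => s t * G t) L x) - (k + RInt (fun t => s t * g n t) L x)))
    by (rewrite Hrec; ring).
  eapply Rle_trans; [apply Rabs_triang|]. rewrite Rabs_Ropp.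
  assert (Y := RInt_mult_sub_bound s G (g n) k (2 * B * (/ 2) ^ n) x Hs Hsb HG (Hg n)).
  assert (Y' : forall t, Rabs (G t - g n t) <= 2 * B * (/ 2) ^ n * e t).
  { intros t. replace (2 * B * (/ 2) ^ n * e t) with (2 * (B * e t) * (/ 2) ^ n) by ring.
    apply Hgb. }
  specialize (Y Y'). specialize (Hf (S n) x). simpl pow in Hf.
  replace (2 * B * (/ 2) ^ n / 2 * e x) with (B * e x * (/ 2) ^ n) in Y by field. lra.
Qed.

Lemma picard_sol :
  exists U P, U L = u0 /\ P L = p0 /\
    forall x, is_derive U x (r x * P x) /\ is_derive P x (c x * U x).
Proof.
  assert (CU : forall x, continuous U x).
  { apply (CVU_geom_cont (fun n => fst (picard n))); intros;
      [apply picard_cont|apply picard_lim]. }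
  assert (CP : forall x, continuous P x).
  { apply (CVU_geom_cont (fun n => snd (picard n))); intros;
      [apply picard_cont|apply picard_lim]. }
  assert (EU : forall x, U x = u0 + RInt (fun t => r t * P t) L x).
  { apply (integral_eq_of_picard (fun n => fst (picard n)) (fun n => snd (picard n)));
      auto; intros; try apply picard_cont; apply picard_lim. }
  assert (EP : forall x, P x = p0 + RInt (fun t => c t * U t) L x).
  { apply (integral_eq_of_picard (fun n => snd (picard n)) (fun n => fst (picard n)));
      auto; intros; try apply picard_cont; apply picard_lim. }
  exists U, P. split; [|split; [|intros x; split]].
  - rewrite EU, RInt_point0. apply Rplus_0_r.
  - rewrite EP, RInt_point0. apply Rplus_0_r.
  - apply (is_derive_Rext (fun x => u0 + RInt (fun t => r t * P t) L x)); [easy|].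
    apply is_derive_shift, (is_derive_RInt_cont (fun t => r t * P t)).
    intros t. now apply (continuous_mult r P).
  - apply (is_derive_Rext (fun x => p0 + RInt (fun t => c t * U t) L x)); [easy|].
    apply is_derive_shift, (is_derive_RInt_cont (fun t => c t * U t)).
    intros t. now apply (continuous_mult c U).
Qed.
End Picard.

Lemma continuous_Rmax_comp (f g : R -> R) (x : R) :
  continuous f x -> continuous g x -> continuous (fun t => Rmax (f t) (g t)) x.
Proof.
  intros Hf Hg.
  apply (continuous_ext (fun t => / 2 * ((f t + g t) + Rabs (f t - g t)))).
  - intros t. unfold Rmax, Rabs. destruct (Rle_dec (f t) (g t)), (Rcase_abs (f t - g t)); lra.
  - apply (continuous_mult (fun _ => / 2) (fun t => (f t + g t) + Rabs (f t - g t)));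
      [apply continuous_const|].
    apply (continuous_plus (fun t => f t + g t) (fun t => Rabs (f t - g t))).
    + now apply (continuous_plus f g).
    + apply (continuous_Rabs_comp (fun t => f t - g t)). now apply (continuous_minus f g).
Qed.

Lemma continuous_Rmin_comp (f g : R -> R) (x : R) :
  continuous f x -> continuous g x -> continuous (fun t => Rmin (f t) (g t)) x.
Proof.
  intros Hf Hg.
  apply (continuous_ext (fun t => - Rmax (- f t) (- g t))).
  - intros t. now rewrite Ropp_Rmax, !Ropp_involutive.
  - apply (continuous_opp (fun t => Rmax (- f t) (- g t))), continuous_Rmax_comp.
    + now apply (continuous_opp f).
    + now apply (continuous_opp g).
Qed.

(** Clamping the argument by [cl] turns continuous coefficients into globally bounded ones without
    changing them on [a, b], so the global Picard solution applies. *)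
Lemma linear_ivp (r c : R -> R) (a b u0 p0 : R) :
  (forall x, continuous r x) -> (forall x, continuous c x) ->
  exists U P, U a = u0 /\ P a = p0 /\ sol r c a b U P.
Proof.
  intros Hr Hc.
  set (cl := fun x => Rmax (a - 1) (Rmin x (b + 1))).
  assert (Hcl : forall x, continuous cl x).
  { intros x. apply continuous_Rmax_comp; [apply continuous_const|].
    apply continuous_Rmin_comp; [apply continuous_id|apply continuous_const]. }
  (* No order between [a] and [b] is assumed; the outer [Rmax] keeps the range of [cl] correct when
     [b + 1 < a - 1]. *)
  destruct (continuous_bounded (fun x => Rmax (Rabs (r x)) (Rabs (c x)))
              (a - 1) (Rmax (a - 1) (b + 1))) as [M [HM Hb]].
  { intros x _. apply continuous_Rmax_comp; now apply continuous_Rabs_comp. }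
  assert (Hb' : forall x, Rabs (r (cl x)) <= M /\ Rabs (c (cl x)) <= M).
  { intros x. assert (I : a - 1 <= cl x <= Rmax (a - 1) (b + 1)).
    { split; [apply Rmax_l|].
      unfold cl. apply Rle_max_compat_l, Rmin_r. }
    specialize (Hb _ I). assert (X := Rle_abs (Rmax (Rabs (r (cl x))) (Rabs (c (cl x))))).
    assert (Y := Rmax_l (Rabs (r (cl x))) (Rabs (c (cl x)))).
    assert (Z := Rmax_r (Rabs (r (cl x))) (Rabs (c (cl x)))). lra. }
  destruct (picard_sol (fun x => r (cl x)) (fun x => c (cl x)) M a u0 p0 HM)
    as [U [P [HU [HP S]]]].
  - intros x. apply (continuous_comp cl r); auto.
  - intros x. apply (continuous_comp cl c); auto.
  - intros x; apply Hb'.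
  - intros x; apply Hb'.
  - exists U, P. split; [easy|split; [easy|]]. intros x Hx. specialize (S x).
    simpl in S. replace (cl x) with x in S; [easy|].
    unfold cl. rewrite Rmin_left, Rmax_right; lra.
Qed.

(** Gronwall for N = (U1 - U2)^2 + (P1 - P2)^2. Writing c1 U1 - c2 U2 = c1 (U1 - U2) + (c1 - c2) U2
    explains why only [U2] has to be bounded. The rate 2M + 1 consists of 2M from [r + c1] and 1
    from 2pw <= p^2 + w^2; the constant D = d^2 M^2 bounds w^2, and adding it to N makes the
    inequality homogeneous. *)
Lemma energy_estimate (r c1 c2 : R -> R) (a b : R) (U1 P1 U2 P2 : R -> R) (M d : R) :
  sol r c1 a b U1 P1 -> sol r c2 a b U2 P2 ->
  U1 a = U2 a -> P1 a = P2 a -> 0 <= M -> 0 <= d ->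
  (forall x, a <= x <= b -> Rabs (r x) <= M /\ Rabs (c1 x) <= M /\
     Rabs (U2 x) <= M /\ Rabs (c1 x - c2 x) <= d) ->
  forall x, a <= x <= b ->
    (U1 x - U2 x) ^ 2 + (P1 x - P2 x) ^ 2 <= d ^ 2 * (M ^ 2 * exp ((2 * M + 1) * (b - a))).
Proof.
  intros S1 S2 EU EP HM Hd Hb x Hx.
  set (K := 2 * M + 1). set (D := d ^ 2 * M ^ 2).
  assert (HD : 0 <= D) by (apply Rmult_le_pos; apply pow2_ge_0).
  set (f := fun t => - (((U1 t - U2 t) ^ 2 + (P1 t - P2 t) ^ 2 + D) * exp (- K * (t - a)))).
  set (df := fun t => (K * ((U1 t - U2 t) ^ 2 + (P1 t - P2 t) ^ 2 + D)
    - (2 * (U1 t - U2 t) * (r t * P1 t - r t * P2 t)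
       + 2 * (P1 t - P2 t) * (c1 t * U1 t - c2 t * U2 t))) * exp (- K * (t - a))).
  assert (H : f a <= f x).
  { apply (mono_le f df); [lra| |].
    - intros t Ht. destruct (S1 t) as [A1 B1]; [lra|]. destruct (S2 t) as [A2 B2]; [lra|].
      unfold f, df. auto_derive.
      + repeat split; eexists; eassumption.
      + derive_rw A1. derive_rw A2. derive_rw B1. derive_rw B2. unfold Rminus. ring.
    - intros t Ht. unfold df. apply Rmult_le_pos; [|apply Rlt_le, exp_pos].
      destruct (Hb t) as [Br [Bc [Bu Bd]]]; [lra|].
      apply Rabs_le_between in Br. apply Rabs_le_between in Bc.
      set (u := U1 t - U2 t). set (p := P1 t - P2 t).
      replace (2 * u * (r t * P1 t - r t * P2 t) + 2 * p * (c1 t * U1 t - c2 t * U2 t))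
        with (2 * (u * p) * (r t + c1 t) + 2 * p * ((c1 t - c2 t) * U2 t))
        by (unfold u, p; ring).
      set (w := (c1 t - c2 t) * U2 t).
      assert (Hw : w ^ 2 <= D).
      { unfold w, D. rewrite Rpow_mult_distr.
        apply Rmult_le_compat; try apply pow2_ge_0; apply pow_maj_Rabs; easy. }
      assert (X1 : 2 * (u * p) * (r t + c1 t) <= 2 * M * (u ^ 2 + p ^ 2)).
      { assert (0 <= (u - p) ^ 2) by apply pow2_ge_0.
        assert (0 <= (u + p) ^ 2) by apply pow2_ge_0. nra. }
      assert (X2 : 2 * p * w <= p ^ 2 + w ^ 2) by (assert (X := pow2_ge_0 (p - w)); nra).
      assert (0 <= u ^ 2) by apply pow2_ge_0.
      assert (0 <= M * D) by (apply Rmult_le_pos; easy).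
      unfold K. nra. }
  unfold f in H. rewrite EU, EP in H.
  replace (- K * (a - a)) with 0 in H by ring. rewrite exp_0 in H.
  set (N := (U1 x - U2 x) ^ 2 + (P1 x - P2 x) ^ 2) in *.
  assert (H' : (N + D) * exp (- K * (x - a)) <= D) by nra.
  assert (E0 := exp_pos (K * (x - a))).
  apply (Rmult_le_compat_r (exp (K * (x - a)))) in H'; [|lra].
  rewrite Rmult_assoc, <- exp_plus in H'.
  replace (- K * (x - a) + K * (x - a)) with 0 in H' by ring. rewrite exp_0 in H'.
  assert (E1 : exp (K * (x - a)) <= exp (K * (b - a))).
  { destruct (Req_dec x b) as [->|]; [lra|]. left. apply exp_increasing.
    apply Rmult_lt_compat_l; unfold K; lra. }
  rewrite <- Rmult_assoc. fold D. nra.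
Qed.

(** Backward uniqueness: with M bounding |r + c|, the function (U^2 + P^2) exp(M t) is
    nondecreasing, so vanishing at [b] forces vanishing at [a]. *)
Lemma sol_double_zero (r c : R -> R) (a b : R) (U P : R -> R) :
  a <= b -> (forall x, continuous r x) -> (forall x, continuous c x) ->
  sol r c a b U P -> U b = 0 -> P b = 0 -> U a = 0.
Proof.
  intros ab Hr Hc S EU EP.
  destruct (continuous_bounded (fun x => r x + c x) a b) as [M [HM Hb]].
  { intros x _. now apply (continuous_plus r c). }
  set (f := fun t => (U t ^ 2 + P t ^ 2) * exp (M * t)).
  set (df := fun t => (M * (U t ^ 2 + P t ^ 2) + 2 * (U t * P t) * (r t + c t)) * exp (M * t)).
  assert (H : f a <= f b).
  { apply (mono_le f df); [easy| |].
    - intros t Ht. destruct (S t) as [A1 B1]; [easy|].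
      unfold f, df. auto_derive.
      + repeat split; eexists; eassumption.
      + derive_rw A1. derive_rw B1. ring.
    - intros t Ht. unfold df. apply Rmult_le_pos; [|apply Rlt_le, exp_pos].
      specialize (Hb t Ht). apply Rabs_le_between in Hb.
      assert (0 <= (U t - P t) ^ 2) by apply pow2_ge_0.
      assert (0 <= (U t + P t) ^ 2) by apply pow2_ge_0. nra. }
  unfold f in H. rewrite EU, EP in H. assert (E := exp_pos (M * a)).
  replace ((0 ^ 2 + 0 ^ 2) * exp (M * b)) with 0 in H by ring.
  assert (X := pow2_ge_0 (U a)). assert (Y := pow2_ge_0 (P a)).
  assert (Z : U a ^ 2 = 0) by nra. now apply Rsqr_0_uniq; rewrite Rsqr_pow2.
Qed.

Lemma first_nonpos (f : R -> R) (a b : R) :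
  a <= b -> (forall x, a <= x <= b -> continuous f x) -> 0 < f a -> f b <= 0 ->
  exists x0, a < x0 <= b /\ f x0 <= 0 /\ forall y, a <= y < x0 -> 0 < f y.
Proof.
  intros ab Hc Ha Hb.
  set (E := fun x => a <= x <= b /\ forall y, a <= y <= x -> 0 < f y).
  destruct (completeness E) as [s [Hs1 Hs2]].
  { exists b. intros x [Hx _]. lra. }
  { exists a. split; [lra|]. intros y Hy. now replace y with a by lra. }
  assert (as_ : a <= s).
  { apply Hs1. split; [lra|]. intros y Hy. now replace y with a by lra. }
  assert (sb : s <= b) by (apply Hs2; intros x [Hx _]; lra).
  assert (below : forall y, a <= y < s -> 0 < f y).
  { intros y Hy. destruct (Rlt_dec 0 (f y)) as [|N]; [easy|exfalso].
    assert (s <= y); [|lra].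
    apply Hs2. intros x [Hx H]. destruct (Rle_dec x y) as [|Hxy]; [easy|].
    exfalso. apply N, H. lra. }
  assert (fs : f s <= 0).
  { destruct (Rle_dec (f s) 0) as [|N]; [easy|exfalso].
    assert (s < b) by (destruct (Req_dec s b) as [->|]; lra).
    assert (L : locally s (fun y => 0 < f y)).
    { apply (Hc s ltac:(lra) (fun v => 0 < v)).
      apply (open_gt 0). lra. }
    destruct L as [e He].
    set (h := Rmin (e / 2) (b - s)).
    assert (0 < e) by apply cond_pos.
    assert (Hh : 0 < h) by (apply Rmin_glb_lt; lra).
    assert (h <= e / 2) by apply Rmin_l. assert (h <= b - s) by apply Rmin_r.
    assert (E (s + h)).
    { split; [lra|]. intros y Hy. destruct (Rlt_dec y s) as [|Hys]; [apply below; lra|].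
      apply He. change (Rabs (y - s) < e). rewrite Rabs_pos_eq; lra. }
    specialize (Hs1 _ H3). lra. }
  exists s. split; [|split; easy].
  split; [|easy]. destruct (Req_dec a s) as [->|]; lra.
Qed.

(** * Riccati barriers *)

(* With E' = r s E one has (E (P - s U))' = E [defect] U, so that a defect of constant
   sign propagates the sign of P - s U when U > 0. *)
Definition defect (r c s ds : R -> R) (x : R) : R := c x - ds x - r x * s x ^ 2.

Section Barrier.
Variables (r c s ds : R -> R) (a b : R) (U P : R -> R).
Hypothesis r_cont : forall x, continuous r x.
Hypothesis s_derive : forall x, is_derive s x (ds x).
Hypothesis US : sol r c a b U P.

Let E x := exp (RInt (fun t => r t * s t) 0 x).

Lemma integrating_factor_derive (x : R) : is_derive E x (r x * s x * E x).
Proof.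
  assert (H : is_derive (fun y => RInt (fun t => r t * s t) 0 y) x (r x * s x)).
  { apply (is_derive_RInt_cont (fun t => r t * s t)). intros t.
    apply (continuous_mult r s); [easy|]. now apply (is_derive_cont s t (ds t)). }
  unfold E.
  apply (is_derive_comp exp (fun y => RInt (fun t => r t * s t) 0 y)); [|easy].
  apply is_derive_exp.
Qed.

Lemma integrating_factor_pos (x : R) : 0 < E x.
Proof. apply exp_pos. Qed.

Lemma barrier_derive (x : R) :
  a <= x <= b ->
  is_derive (fun x => E x * (P x - s x * U x)) x (E x * (defect r c s ds x * U x)).
Proof.
  intros Hx. destruct (US x Hx) as [HU HP].
  assert (HE := integrating_factor_derive x). assert (Hs := s_derive x).
  auto_derive.
  - repeat split; eexists; eassumption.
  - derive_rw HU. derive_rw HP. derive_rw HE. derive_rw Hs. unfold defect. ring.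
Qed.

(** [k] is the ratio of the integrating factors at the two ends. It stays existential because only
    the sign of P - s U is ever transported. *)
Lemma barrier_sub :
  a <= b -> (forall x, a <= x <= b -> 0 <= defect r c s ds x * U x) ->
  exists k, 0 < k /\ P a - s a * U a <= k * (P b - s b * U b).
Proof.
  intros ab H. exists (E b / E a).
  assert (Ea := integrating_factor_pos a). assert (Eb := integrating_factor_pos b).
  split; [now apply Rdiv_lt_0_compat|].
  assert (X : E a * (P a - s a * U a) <= E b * (P b - s b * U b)).
  { apply (mono_le (fun x => E x * (P x - s x * U x))
             (fun x => E x * (defect r c s ds x * U x))); [easy| |].
    - intros; now apply barrier_derive.
    - intros x Hx. apply Rmult_le_pos; [apply Rlt_le, integrating_factor_pos|auto]. }
  apply (Rmult_le_reg_l (E a)); [easy|].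
  replace (E a * (E b / E a * (P b - s b * U b))) with (E b * (P b - s b * U b))
    by (field; lra). easy.
Qed.

Lemma barrier_super :
  a <= b -> (forall x, a <= x <= b -> defect r c s ds x * U x <= 0) ->
  exists k, 0 < k /\ k * (P b - s b * U b) <= P a - s a * U a.
Proof.
  intros ab H. exists (E b / E a).
  assert (Ea := integrating_factor_pos a). assert (Eb := integrating_factor_pos b).
  split; [now apply Rdiv_lt_0_compat|].
  assert (X : - (E a * (P a - s a * U a)) <= - (E b * (P b - s b * U b))).
  { apply (mono_le (fun x => - (E x * (P x - s x * U x)))
             (fun x => - (E x * (defect r c s ds x * U x)))); [easy| |].
    - intros x Hx. apply (is_derive_opp (fun x => E x * (P x - s x * U x))).
      now apply barrier_derive.
    - intros x Hx. specialize (H x Hx). assert (Ex := integrating_factor_pos x). nra. }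
  apply (Rmult_le_reg_l (E a)); [easy|].
  replace (E a * (E b / E a * (P b - s b * U b))) with (E b * (P b - s b * U b))
    by (field; lra). lra.
Qed.

(** Here positivity of [U] is a conclusion. Up to a first zero x0 the barrier keeps P - s U >= 0,
    hence (U / E)' = r (P - s U) / E >= 0, and U / E cannot fall from a positive value to zero. *)
Lemma barrier_pos :
  (forall x, 0 <= r x) -> 0 < U a -> 0 <= P a - s a * U a ->
  (forall x, a <= x <= b -> 0 <= defect r c s ds x) ->
  forall x, a <= x <= b -> 0 < U x.
Proof.
  intros Hr Ua Ya Hd x1 Hx1. destruct (Rlt_dec 0 (U x1)) as [|N]; [easy|exfalso].
  destruct (first_nonpos U a x1) as [x0 [Hx0 [U0 Upos]]]; try easy; try lra.
  { intros x Hx. apply (is_derive_cont U x (r x * P x)), US. lra. }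
  assert (Unn : forall x, a <= x <= x0 -> 0 <= defect r c s ds x * U x \/ x = x0).
  { intros x Hx. destruct (Req_dec x x0) as [|Hne]; [now right|left].
    apply Rmult_le_pos; [apply Hd; lra|]. apply Rlt_le, Upos. lra. }
  assert (Y : forall x, a <= x < x0 -> 0 <= E x * (P x - s x * U x)).
  { intros x Hx. apply (Rle_trans _ (E a * (P a - s a * U a))).
    - apply Rmult_le_pos; [apply Rlt_le, integrating_factor_pos|easy].
    - apply (mono_le (fun x => E x * (P x - s x * U x))
               (fun x => E x * (defect r c s ds x * U x))); [lra| |].
      + intros; apply barrier_derive; lra.
      + intros y Hy. apply Rmult_le_pos; [apply Rlt_le, integrating_factor_pos|].
        destruct (Unn y); lra. }
  (* Before x0 positivity of [U] gives the sign; at x0 itself it is recovered by continuity, so that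
     the monotonicity below can use the closed interval. *)
  assert (Y' : forall x, a <= x <= x0 -> 0 <= P x - s x * U x).
  { assert (Z : forall x, a <= x < x0 -> 0 <= P x - s x * U x).
    { intros x Hx. specialize (Y x Hx). assert (Ex := integrating_factor_pos x). nra. }
    intros x Hx. destruct (Rlt_dec x x0) as [|Hne]; [apply Z; lra|].
    replace x with x0 by lra.
    destruct (Rle_dec 0 (P x0 - s x0 * U x0)) as [|Neg]; [easy|exfalso].
    assert (C : continuous (fun x => P x - s x * U x) x0).
    { destruct (US x0) as [HU HP]; [lra|].
      apply (continuous_minus P (fun x => s x * U x)).
      - now apply (is_derive_cont P x0 (c x0 * U x0)).
      - apply (continuous_mult s U).
        + now apply (is_derive_cont s x0 (ds x0)).
        + now apply (is_derive_cont U x0 (r x0 * P x0)). }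
    destruct (C (fun v => v < 0)) as [e He]; [apply (open_lt 0); lra|].
    assert (0 < e) by apply cond_pos.
    set (y := Rmax a (x0 - e / 2)).
    assert (a <= y) by apply Rmax_l. assert (x0 - e / 2 <= y) by apply Rmax_r.
    assert (y < x0) by (apply Rmax_lub_lt; lra).
    assert (V : P y - s y * U y < 0).
    { apply He. change (Rabs (y - x0) < e). rewrite Rabs_left1; lra. }
    specialize (Z y). lra. }
  assert (W : U a / E a <= U x0 / E x0).
  { apply (mono_le (fun x => U x / E x) (fun x => r x * (P x - s x * U x) / E x)); [lra| |].
    - intros x Hx. destruct (US x) as [HU HP]; [lra|].
      assert (HE := integrating_factor_derive x). assert (Ex := integrating_factor_pos x).
      auto_derive.
      + repeat split; try (eexists; eassumption). lra.
      + derive_rw HU. derive_rw HE. field. lra.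
    - intros x Hx. assert (Ex := integrating_factor_pos x).
      apply Rdiv_le_0_compat; [|easy]. apply Rmult_le_pos; auto. }
  assert (0 < U a / E a) by (apply Rdiv_lt_0_compat; [easy|apply integrating_factor_pos]).
  assert (E0 := integrating_factor_pos x0).
  assert (0 < U x0 / E x0 * E x0) by (apply Rmult_lt_0_compat; lra).
  replace (U x0 / E x0 * E x0) with (U x0) in H0 by (field; lra). lra.
Qed.
End Barrier.

Lemma Rabs_le_of_sqr (x y : R) : 0 <= y -> x ^ 2 <= y ^ 2 -> Rabs x <= y.
Proof. intros Hy H. apply Rabs_le_between. nra. Qed.

Lemma exp_ge_1 (x : R) : 0 <= x -> 1 <= exp x.
Proof. intros H. assert (X := exp_ineq1_le x). lra. Qed.

Lemma small_step (K l l2 eps : R) :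
  0 <= K -> l < l2 -> 0 < eps -> exists l', l < l' <= l2 /\ K * Rabs (l' - l) < eps.
Proof.
  intros HK Hl He. set (h := Rmin (l2 - l) (eps / (K + 1))).
  assert (0 < eps / (K + 1)) by (apply Rdiv_lt_0_compat; lra).
  assert (Hh : 0 < h) by (apply Rmin_glb_lt; lra).
  assert (h <= l2 - l) by apply Rmin_l. assert (H2 : h <= eps / (K + 1)) by apply Rmin_r.
  exists (l + h). split; [lra|]. replace (l + h - l) with h by ring.
  rewrite Rabs_pos_eq by lra.
  apply (Rmult_le_compat_r (K + 1)) in H2; [|lra].
  unfold Rdiv in H2. rewrite Rmult_assoc, Rinv_l, Rmult_1_r in H2 by lra. lra.
Qed.

(** * Shooting in a scalar parameter *)

Section Shooting.
Variables (r : R -> R) (c : R -> R -> R) (a b p0 m l1 l2 kap : R).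
Hypothesis ab : a < b.
Hypothesis l12 : l1 <= l2.
Hypothesis r_cont : forall x, continuous r x.
Hypothesis r_pos : forall x, 0 < r x.
Hypothesis c_cont : forall l x, continuous (c l) x.
Hypothesis kap_nonneg : 0 <= kap.
Hypothesis c_lip : forall l l' x, a <= x <= b -> Rabs (c l x - c l' x) <= kap * Rabs (l - l').

(** Lipschitz dependence on the level. The summand [kap * (l2 - l1)] in [M] bounds the change of [c]
    over the parameter range, so that one [M] serves all levels. *)
Lemma sol_stable (l0 : R) (U0 P0 : R -> R) :
  sol r (c l0) a b U0 P0 ->
  exists K, 0 <= K /\ forall l U P, l1 <= l <= l2 -> l1 <= l0 <= l2 ->
    sol r (c l) a b U P -> U a = U0 a -> P a = P0 a ->
    forall x, a <= x <= b ->
      Rabs (U x - U0 x) <= K * Rabs (l - l0) /\ Rabs (P x - P0 x) <= K * Rabs (l - l0).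
Proof.
  intros S0.
  destruct (continuous_bounded r a b) as [M1 [HM1 Hb1]]; [auto|].
  destruct (continuous_bounded (c l0) a b) as [M2 [HM2 Hb2]]; [auto|].
  destruct (continuous_bounded U0 a b) as [M3 [HM3 Hb3]].
  { intros x Hx. apply (is_derive_cont U0 x (r x * P0 x)), S0, Hx. }
  set (M := M1 + M2 + M3 + kap * (l2 - l1)).
  assert (HkL : 0 <= kap * (l2 - l1)) by (apply Rmult_le_pos; lra).
  set (G := exp ((2 * M + 1) * (b - a))).
  assert (HG : 1 <= G).
  { apply exp_ge_1, Rmult_le_pos; unfold M; lra. }
  exists (kap * (M * G)). split.
  { apply Rmult_le_pos; [easy|]. apply Rmult_le_pos; unfold M; lra. }
  intros l U P Hl Hl0 S EU EP x Hx.
  set (d := kap * Rabs (l - l0)).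
  assert (Hd : 0 <= d) by (apply Rmult_le_pos; [easy|apply Rabs_pos]).
  assert (En := energy_estimate r (c l) (c l0) a b U P U0 P0 M d S S0 EU EP
                  ltac:(unfold M; lra) Hd).
  assert (En' := fun H => En H x Hx). clear En.
  replace (kap * (M * G) * Rabs (l - l0)) with (d * (M * G)) by (unfold d; ring).
  assert (HMG : 0 <= M * G) by (apply Rmult_le_pos; unfold M; lra).
  assert (HdMG : 0 <= d * (M * G)) by (apply Rmult_le_pos; easy).
  assert (T : (U x - U0 x) ^ 2 + (P x - P0 x) ^ 2 <= (d * (M * G)) ^ 2).
  { eapply Rle_trans; [apply En'|].
    - intros y Hy. specialize (Hb1 y Hy). specialize (Hb2 y Hy). specialize (Hb3 y Hy).
      assert (Hc := c_lip l l0 y Hy). fold d in Hc.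
      assert (d <= kap * (l2 - l1)).
      { apply Rmult_le_compat_l; [easy|]. apply Rabs_le_between; lra. }
      split; [|split; [|split]]; try (unfold M; lra).
      replace (c l y) with ((c l y - c l0 y) + c l0 y) by ring.
      eapply Rle_trans; [apply Rabs_triang|]. unfold M; lra.
    - fold G. replace ((d * (M * G)) ^ 2) with (d ^ 2 * (M ^ 2 * G ^ 2)) by ring.
      apply Rmult_le_compat_l; [apply pow2_ge_0|].
      apply Rmult_le_compat_l; [apply pow2_ge_0|]. nra. }
  assert (X := pow2_ge_0 (U x - U0 x)). assert (Y := pow2_ge_0 (P x - P0 x)).
  split; apply Rabs_le_of_sqr; lra.
Qed.

(** A zero of a nonnegative [U] is a double zero: a nonzero slope would produce negative values on
    one side, and at [b], where no right side exists, the inequality [m * U b <= P b] excludes a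
    negative slope. A double zero contradicts [U a = 1]. *)
Lemma sol_nonneg_pos (l : R) (U P : R -> R) :
  sol r (c l) a b U P -> U a = 1 -> m * U b <= P b ->
  (forall x, a <= x <= b -> 0 <= U x) -> forall x, a <= x <= b -> 0 < U x.
Proof.
  intros S Ua Db Unn x Hx.
  destruct (Rle_lt_or_eq_dec 0 (U x) (Unn x Hx)) as [|E]; [easy|exfalso].
  assert (ax : a < x) by (destruct (Req_dec a x) as [->|]; lra).
  destruct (S x Hx) as [HU _]. assert (rp := r_pos x).
  assert (P x = 0).
  { destruct (Rtotal_order (P x) 0) as [Hlt|[|Hgt]]; [|easy|]; exfalso.
    - destruct (Req_dec x b) as [->|Hxb].
      { rewrite <- E in Db. lra. }
      destruct (is_derive_pos_right (fun t => - U t) x b (- (r x * P x))) as [y [Hy H]].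
      + now apply (is_derive_opp U).
      + nra.
      + lra.
      + specialize (Unn y). lra.
    - destruct (is_derive_pos_left U a x (r x * P x)) as [y [Hy H]]; [easy|nra|easy|].
      specialize (Unn y). lra. }
  assert (U a = 0); [|lra].
  apply (sol_double_zero r (c l) a x U P); auto; [lra|].
  apply (sol_sub r (c l) a b); auto; lra.
Qed.

(** A level is good if its solution is positive and overshoots strictly at [b]. At the supremum l0
    of the levels that are not good, limits of good levels give U >= 0 and P b >= m U b, and strict
    overshoot would make all levels near l0 good. Positivity is a premise at the low end, since
    losing it already means not good, but must be supplied at the high end. *)
Lemma shooting :
  (forall U P, sol r (c l1) a b U P -> U a = 1 -> P a = p0 ->
     (forall x, a <= x <= b -> 0 < U x) -> P b <= m * U b) ->
  (forall U P, sol r (c l2) a b U P -> U a = 1 -> P a = p0 ->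
     (forall x, a <= x <= b -> 0 < U x) /\ m * U b <= P b) ->
  exists l U P, l1 <= l <= l2 /\ sol r (c l) a b U P /\ U a = 1 /\ P a = p0 /\
    (forall x, a <= x <= b -> 0 < U x) /\ P b = m * U b.
Proof.
  intros low high.
  set (good := fun l => exists U P, sol r (c l) a b U P /\ U a = 1 /\ P a = p0 /\
    (forall x, a <= x <= b -> 0 < U x) /\ m * U b < P b).
  set (E := fun l => l1 <= l <= l2 /\ ~ good l).
  assert (E1 : E l1).
  { split; [lra|]. intros [U [P [S [Ua [Pa [Up D]]]]]].
    specialize (low U P S Ua Pa Up). lra. }
  destruct (completeness E) as [l0 [up least]].
  { exists l2. intros l [Hl _]. lra. }
  { now exists l1. }
  assert (Hl0 : l1 <= l0 <= l2).
  { split; [now apply up|]. apply least. intros l [Hl _]. lra. }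
  destruct (linear_ivp r (c l0) a b 1 p0) as [U0 [P0 [Ua [Pa S0]]]]; auto.
  destruct (sol_stable l0 U0 P0 S0) as [K [HK stab]].
  (* Every level in (l0, l2] is good, as l0 bounds the others; stability gives good solutions
     arbitrarily close to the one at l0. *)
  assert (above : forall eps, 0 < eps -> l0 < l2 -> exists U P,
    (forall x, a <= x <= b -> 0 < U x) /\ m * U b < P b /\
    forall x, a <= x <= b -> Rabs (U x - U0 x) < eps /\ Rabs (P x - P0 x) < eps).
  { intros eps He Hlt. destruct (small_step K l0 l2 eps) as [l [Hl Hs]]; auto.
    assert (G : good l).
    { apply NNPP. intros N. assert (l <= l0) by (apply up; split; [lra|easy]). lra. }
    destruct G as [U [P [S [HUa [HPa [Up D]]]]]]. exists U, P. repeat split; auto.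
    - eapply Rle_lt_trans; [apply (stab l U P); auto; try congruence; lra|easy].
    - eapply Rle_lt_trans; [apply (stab l U P); auto; try congruence; lra|easy]. }
  assert (limit : (forall x, a <= x <= b -> 0 <= U0 x) /\ m * U0 b <= P0 b).
  (* At l0 = l2 there are no levels above to approximate from; the premise [high] takes their
     place. *)
  { destruct (Req_dec l0 l2) as [->|Hne].
    { destruct (high U0 P0) as [H1 H2]; auto. split; [|easy].
      intros x Hx. now apply Rlt_le, H1. }
    split.
    - intros x Hx. destruct (Rle_dec 0 (U0 x)) as [|N]; [easy|exfalso].
      destruct (above (- U0 x)) as [U [P [Up [_ H]]]]; [lra|lra|].
      specialize (Up x Hx). destruct (H x Hx) as [H1 _]. apply Rabs_def2 in H1. lra.
    - destruct (Rle_dec (m * U0 b) (P0 b)) as [|N]; [easy|exfalso].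
      assert (Hm := Rabs_pos m).
      destruct (above ((m * U0 b - P0 b) / (1 + Rabs m))) as [U [P [_ [D H]]]];
        [apply Rdiv_lt_0_compat; lra|lra|].
      destruct (H b) as [H1 H2]; [lra|].
      set (eta := (m * U0 b - P0 b) / (1 + Rabs m)) in *.
      assert (Heta : eta * (1 + Rabs m) = m * U0 b - P0 b) by (unfold eta; field; lra).
      apply Rabs_def2 in H2.
      assert (H3 : Rabs (m * (U b - U0 b)) <= Rabs m * eta).
      { rewrite Rabs_mult. apply Rmult_le_compat_l; lra. }
      apply Rabs_le_between in H3. lra. }
  destruct limit as [Unn D0].
  assert (Upos := sol_nonneg_pos l0 U0 P0 S0 Ua D0 Unn).
  exists l0, U0, P0. repeat split; auto; try lra; try apply S0; auto.
  destruct (Rle_lt_or_eq_dec _ _ D0) as [Dlt|]; [exfalso|easy].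
  destruct (continuity_ab_min U0 a b) as [x0 [Hmin Hx0]]; [lra| |].
  { intros x Hx. apply (is_derive_cont_pt U0 x (r x * P0 x)), S0, Hx. }
  assert (Hm := Rabs_pos m).
  (* A perturbation below [eta] keeps U above zero, as U0 x0 is its minimum, and changes P - m U by
     less than the overshoot, because the error there is at most 1 + |m| times larger. *)
  set (eta := Rmin (U0 x0) ((P0 b - m * U0 b) / (1 + Rabs m))).
  assert (Heta : 0 < eta).
  { apply Rmin_glb_lt; [now apply Upos|]. apply Rdiv_lt_0_compat; lra. }
  assert (eta1 : eta <= U0 x0) by apply Rmin_l.
  assert (eta2 : eta * (1 + Rabs m) <= P0 b - m * U0 b).
  { replace (P0 b - m * U0 b) with ((P0 b - m * U0 b) / (1 + Rabs m) * (1 + Rabs m))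
      by (field; lra).
    apply Rmult_le_compat_r; [lra|apply Rmin_r]. }
  assert (near : forall l, l1 <= l <= l2 -> K * Rabs (l - l0) < eta -> good l).
  { intros l Hl Hs. destruct (linear_ivp r (c l) a b 1 p0) as [U [P [HUa [HPa S]]]]; auto.
    assert (st := stab l U P Hl Hl0 S ltac:(congruence) ltac:(congruence)).
    exists U, P. repeat split; auto; try apply S; auto.
    - intros x Hx. destruct (st x Hx) as [H1 _]. apply Rabs_le_between in H1.
      specialize (Hmin x Hx). lra.
    - destruct (st b) as [H1 H2]; [lra|].
      assert (H3 : Rabs (m * (U b - U0 b)) <= Rabs m * (K * Rabs (l - l0))).
      { rewrite Rabs_mult. apply Rmult_le_compat_l; lra. }
      apply Rabs_le_between in H2. apply Rabs_le_between in H3.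
      assert (Rabs m * (K * Rabs (l - l0)) <= Rabs m * eta)
        by (apply Rmult_le_compat_l; lra). lra. }
  set (h := eta / (K + 1)).
  assert (Hh : 0 < h) by (apply Rdiv_lt_0_compat; lra).
  assert (l0 <= l0 - h); [|lra].
  apply least. intros l [Hl N]. destruct (Rle_dec l (l0 - h)) as [|Hg]; [easy|exfalso].
  apply N, near; [easy|].
  assert (l <= l0) by (apply up; now split).
  rewrite Rabs_left1 by lra.
  assert (h * (K + 1) = eta) by (unfold h; field; lra). nra.
Qed.
End Shooting.

(** * Picone's identity *)

(** J = V (Q - V P / U) has derivative r (Q - V P / U)^2 + (c2 - c1) V^2 >= 0, and the common Robin
    coefficients make J vanish at both ends. A point with V <> 0 would make the increase strict. *)
Lemma positive_sol_maximal (r c1 c2 : R -> R) (a b ka kb : R) (U P V Q : R -> R) :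
  a < b -> (forall x, 0 <= r x) ->
  sol r c1 a b U P -> sol r c2 a b V Q ->
  (forall x, a <= x <= b -> 0 < U x) ->
  P a = ka * U a -> P b = kb * U b -> Q a = ka * V a -> Q b = kb * V b ->
  (forall x, a <= x <= b -> c1 x < c2 x) ->
  forall x, a <= x <= b -> V x = 0.
Proof.
  intros ab Hr SU SV Up Pa Pb Qa Qb Hc x0 Hx0.
  destruct (Req_dec (V x0) 0) as [|Hne]; [easy|exfalso].
  set (J := fun x => V x * (Q x - V x * P x / U x)).
  set (dJ := fun x => r x * (Q x - V x * P x / U x) ^ 2 + (c2 x - c1 x) * V x ^ 2).
  assert (H : J a < J b).
  { apply (mono_lt J dJ a b x0); try easy.
    - intros x Hx. destruct (SU x Hx) as [A1 B1]. destruct (SV x Hx) as [A2 B2].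
      specialize (Up x Hx). unfold J, dJ. auto_derive.
      + repeat split; try (eexists; eassumption). lra.
      + derive_rw A1. derive_rw A2. derive_rw B1. derive_rw B2. field. lra.
    - intros x Hx. specialize (Hc x Hx). unfold dJ.
      apply Rplus_le_le_0_compat; apply Rmult_le_pos; try apply pow2_ge_0; auto; lra.
    - specialize (Hc x0 Hx0). unfold dJ.
      apply Rplus_le_lt_0_compat; [apply Rmult_le_pos; auto using pow2_ge_0|].
      apply Rmult_lt_0_compat; [lra|]. now apply pow2_gt_0. }
  assert (Ua := Up a ltac:(lra)). assert (Ub := Up b ltac:(lra)).
  unfold J in H. rewrite Pa, Pb, Qa, Qb in H.
  replace (V a * (ka * V a - V a * (ka * U a) / U a)) with 0 in H by (field; lra).
  replace (V b * (kb * V b - V b * (kb * U b) / U b)) with 0 in H by (field; lra).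
  lra.
Qed.

Lemma wronskian_lt (r c1 c2 : R -> R) (a b : R) (U P V Q : R -> R) :
  a < b -> sol r c1 a b U P -> sol r c2 a b V Q ->
  (forall x, a <= x <= b -> 0 < U x) -> (forall x, a <= x <= b -> 0 < V x) ->
  (forall x, a <= x <= b -> c1 x < c2 x) ->
  Q a * U a - P a * V a < Q b * U b - P b * V b.
Proof.
  intros ab SU SV Up Vp Hc.
  assert (D : forall x, a <= x <= b -> 0 < (c2 x - c1 x) * (U x * V x)).
  { intros x Hx. apply Rmult_lt_0_compat; [specialize (Hc x Hx); lra|].
    apply Rmult_lt_0_compat; auto. }
  apply (mono_lt (fun x => Q x * U x - P x * V x)
           (fun x => (c2 x - c1 x) * (U x * V x)) a b a); auto; try lra.
  - intros x Hx. destruct (SU x Hx) as [A1 B1]. destruct (SV x Hx) as [A2 B2].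
    auto_derive.
    + repeat split; eexists; eassumption.
    + derive_rw A1. derive_rw A2. derive_rw B1. derive_rw B2. ring.
  - intros x Hx. now apply Rlt_le, D.
  - apply D; lra.
Qed.

(** * One-sided derivatives *)

(** Affine continuation with the end slopes turns derivatives relative to [a, b] into two-sided
    ones, as [sol] demands. *)
Lemma D_in_extend (f df : R -> R) (a b : R) :
  (forall x, a <= x <= b -> D_in f df (fun y => a <= y <= b) x) ->
  exists F, (forall x, a <= x <= b -> F x = f x) /\
    forall x, a <= x <= b -> is_derive F x (df x).
Proof.
  intros H.
  set (F := fun x => if Rlt_dec x a then f a + df a * (x - a)
                     else if Rlt_dec b x then f b + df b * (x - b) else f x).
  assert (FE : forall x, a <= x <= b -> F x = f x).
  { intros x Hx. unfold F. destruct (Rlt_dec x a), (Rlt_dec b x); lra. }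
  exists F. split; [easy|]. intros x Hx.
  apply is_derive_Reals. intros eps He.
  destruct (H x Hx eps He) as [d [Hd Hlim]].
  (* An increment smaller than [da] and [db] leaves [a, b] only if x is the corresponding end point,
     where the difference quotient of the affine piece is exact. *)
  set (da := if Rlt_dec a x then x - a else 1).
  set (db := if Rlt_dec x b then b - x else 1).
  assert (Hda : 0 < da) by (unfold da; destruct (Rlt_dec a x); lra).
  assert (Hdb : 0 < db) by (unfold db; destruct (Rlt_dec x b); lra).
  assert (Hm : 0 < Rmin d (Rmin da db)) by (repeat apply Rmin_glb_lt; lra).
  exists (mkposreal _ Hm). intros h Hh Hs. simpl in Hs.
  assert (Hs1 : Rabs h < d) by (eapply Rlt_le_trans; [apply Hs|apply Rmin_l]).
  assert (Hs2 : Rabs h < da).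
  { eapply Rlt_le_trans; [apply Hs|]. eapply Rle_trans; [apply Rmin_r|apply Rmin_l]. }
  assert (Hs3 : Rabs h < db).
  { eapply Rlt_le_trans; [apply Hs|]. eapply Rle_trans; [apply Rmin_r|apply Rmin_r]. }
  apply Rabs_def2 in Hs2. apply Rabs_def2 in Hs3.
  rewrite (FE x Hx). unfold F.
  destruct (Rlt_dec (x + h) a) as [Ha|Ha].
  { assert (x = a) as -> by (unfold da in Hs2; destruct (Rlt_dec a x); lra).
    replace ((f a + df a * (a + h - a) - f a) / h - df a) with 0 by (field; easy).
    now rewrite Rabs_R0. }
  destruct (Rlt_dec b (x + h)) as [Hb|Hb].
  { assert (x = b) as -> by (unfold db in Hs3; destruct (Rlt_dec x b); lra).
    replace ((f b + df b * (b + h - b) - f b) / h - df b) with 0 by (field; easy).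
    now rewrite Rabs_R0. }
  specialize (Hlim (x + h)). unfold D_x in Hlim. simpl in Hlim. unfold Rdist in Hlim.
  replace (x + h - x) with h in Hlim by ring. apply Hlim.
  split; [|easy]. split; [lra|]. intros E. apply Hh. lra.
Qed.

Lemma is_derive_D_in (f df : R -> R) (D : R -> Prop) (x : R) :
  is_derive f x (df x) -> D_in f df D x.
Proof.
  intros H. apply is_derive_Reals in H. intros eps He.
  destruct (H eps He) as [d Hd]. exists d. split; [apply cond_pos|].
  intros y [[_ Hy] Hs]. simpl in *. unfold Rdist in *.
  specialize (Hd (y - x)). replace (x + (y - x)) with y in Hd by ring.
  apply Hd; [|easy]. intros E. apply Hy. lra.
Qed.

(** * Valley-shaped functions *)

Lemma limit_ge (H : R -> R) (x y c : R) :
  continuous H x -> x <> y ->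
  (forall z, Rmin x y < z < Rmax x y -> c <= H z) -> c <= H x.
Proof.
  intros Hc Hne Hz. destruct (Rle_dec c (H x)) as [|N]; [easy|exfalso].
  destruct (Hc (fun v => v < c)) as [e He]; [apply (open_lt c); lra|].
  assert (0 < e) by apply cond_pos.
  assert (Hd : 0 < Rabs (y - x)) by (apply Rabs_pos_lt; lra).
  (* With t <= 1/2 the point x + t (y - x) lies strictly between x and y, and the second bound puts
     it within e / 2 of x. *)
  set (t := Rmin (/ 2) (e / (2 * Rabs (y - x)))).
  assert (0 < e / (2 * Rabs (y - x))) by (apply Rdiv_lt_0_compat; lra).
  assert (Ht : 0 < t) by (apply Rmin_glb_lt; lra).
  assert (Ht1 : t <= / 2) by apply Rmin_l.
  assert (Ht2 : t <= e / (2 * Rabs (y - x))) by apply Rmin_r.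
  assert (V : H (x + t * (y - x)) < c).
  { apply He. change (Rabs (x + t * (y - x) - x) < e).
    replace (x + t * (y - x) - x) with (t * (y - x)) by ring.
    rewrite Rabs_mult, (Rabs_pos_eq t) by lra.
    apply (Rmult_le_compat_r (2 * Rabs (y - x))) in Ht2; [|lra].
    replace (e / (2 * Rabs (y - x)) * (2 * Rabs (y - x))) with (pos e) in Ht2
      by (field; lra). lra. }
  assert (c <= H (x + t * (y - x))); [|lra].
  apply Hz. unfold Rmin, Rmax. destruct (Rle_dec x y); nra.
Qed.

Lemma crossing (g : R -> R) (u v : R) :
  (forall x, continuous g x) -> u <= v -> g v <= 0 <= g u ->
  exists x, u <= x <= v /\ g x = 0.
Proof.
  intros Hc uv [Hv Hu].
  destruct (IVT_gen g u v 0) as [x [Hx E]].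
  - intros x. apply continuity_pt_filterlim, Hc.
  - rewrite Rmin_right, Rmax_left; lra.
  - rewrite Rmin_left, Rmax_right in Hx by easy. now exists x.
Qed.

(** Statements about the right branch are obtained from those about the left branch by x -> -x. *)
Lemma valley_reflect (H : R -> R) (l r : R) :
  valley H l r -> valley (fun x => H (- x)) (- r) (- l).
Proof.
  intros [lr [dec [pl [neg [inc pr]]]]]. repeat split.
  - lra.
  - intros x y xy yr. apply inc; lra.
  - intros x Hx. apply pr; lra.
  - intros x Hx. apply neg; lra.
  - intros x y lx xy. apply dec; lra.
  - intros x Hx. apply pl; lra.
Qed.

Lemma continuous_reflect (H : R -> R) :
  (forall x, continuous H x) -> forall x, continuous (fun y => H (- y)) x.
Proof.
  intros Hc x. apply (continuous_comp Ropp H); [|apply Hc].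
  apply (continuous_opp (fun y : R => y)), continuous_id.
Qed.

Section Valley.
Variables (H : R -> R) (l r : R).
Hypothesis H_cont : forall x, continuous H x.
Hypothesis V : valley H l r.

(** Continuity extends the decrease to [l] itself; passing through the midpoint preserves strictness
    in the limit. *)
Lemma valley_dec (x y : R) : x < y -> y <= l -> H y < H x.
Proof.
  destruct V as [lr [dec _]]. intros xy yl.
  set (m := (x + y) / 2).
  assert (H m < H x) by (apply dec; unfold m; lra).
  assert (- H m <= - H y); [|lra].
  apply (limit_ge (fun z => - H z) y m).
  - apply (continuous_opp H), H_cont.
  - unfold m; lra.
  - rewrite Rmin_right, Rmax_left by (unfold m; lra). intros z Hz.
    assert (H z < H m); [|lra]. apply dec; lra.
Qed.

Lemma valley_dec_le (x y : R) : x <= y -> y <= l -> H y <= H x.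
Proof.
  intros xy yl. destruct (Req_dec x y) as [->|]; [lra|]. apply Rlt_le, valley_dec; lra.
Qed.

Lemma valley_left_nonneg : 0 <= H l.
Proof.
  destruct V as [lr [dec [pl _]]]. apply (limit_ge H l (l - 1)); [auto|lra|].
  rewrite Rmin_right, Rmax_left by lra. intros z Hz. apply Rlt_le, pl. lra.
Qed.

(** A nonempty middle interval, where H < 0, would force H l <= 0 by continuity. *)
Lemma valley_left_pos : 0 < H l -> l = r.
Proof.
  destruct V as [lr [dec [pl [neg _]]]]. intros Hp.
  destruct (Req_dec l r) as [|Hne]; [easy|exfalso].
  assert (0 <= - H l); [|lra].
  apply (limit_ge (fun z => - H z) l r); [apply (continuous_opp H), H_cont|easy|].
  rewrite Rmin_left, Rmax_right by easy. intros z Hz. specialize (neg z Hz). lra.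
Qed.

Lemma valley_level (y : R) :
  is_lim H m_infty p_infty -> H l <= y -> exists x, x <= l /\ H x = y.
Proof.
  intros Hl Hy. apply is_lim_spec in Hl. destruct (Hl y) as [M HM].
  set (u := Rmin (M - 1) l).
  assert (u <= M - 1) by apply Rmin_l. assert (u <= l) by apply Rmin_r.
  destruct (crossing (fun x => H x - y) u l) as [x [Hx E]].
  - intros x. apply (continuous_minus H (fun _ => y)); [auto|apply continuous_const].
  - easy.
  - specialize (HM u). lra.
  - exists x. lra.
Qed.
End Valley.

Section ValleyRight.
Variables (H : R -> R) (l r : R).
Hypothesis H_cont : forall x, continuous H x.
Hypothesis V : valley H l r.

Let Hr := continuous_reflect H H_cont.
Let Vr := valley_reflect H l r V.

Lemma valley_inc (x y : R) : r <= x -> x < y -> H x < H y.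
Proof.
  intros rx xy.
  assert (X := valley_dec (fun z => H (- z)) _ _ Hr Vr (- y) (- x) ltac:(lra) ltac:(lra)).
  simpl in X. now rewrite !Ropp_involutive in X.
Qed.

Lemma valley_inc_le (x y : R) : r <= x -> x <= y -> H x <= H y.
Proof.
  intros rx xy. destruct (Req_dec x y) as [->|]; [lra|]. apply Rlt_le, valley_inc; lra.
Qed.

Lemma valley_right_pos : 0 < H r -> l = r.
Proof.
  intros Hp. assert (X := valley_left_pos (fun z => H (- z)) _ _ Hr Vr).
  simpl in X. rewrite Ropp_involutive in X. specialize (X Hp). lra.
Qed.

Lemma valley_right_level (y : R) :
  is_lim H p_infty p_infty -> H r <= y -> exists x, r <= x /\ H x = y.
Proof.
  intros Hl Hy. apply is_lim_spec in Hl.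
  destruct (valley_level (fun z => H (- z)) (- r) Hr y) as [x [Hx E]].
  - apply is_lim_spec. intros M. destruct (Hl M) as [N HN].
    exists (- N). intros z Hz. apply HN. lra.
  - now rewrite Ropp_involutive.
  - exists (- x). split; [lra|easy].
Qed.

(** Since H x > 0 and H decreases up to [l], a later point with a larger value must lie on the
    increasing branch, where H stays above that value. *)
Lemma valley_above (x y z : R) : x < l -> x < y -> H x < H y -> y <= z -> H x <= H z.
Proof.
  intros xl xy Hxy yz. generalize V; intros [lr [dec [pl [neg [inc pr]]]]].
  assert (r <= y).
  { destruct (Rle_dec r y) as [|N]; [easy|exfalso].
    destruct (Rle_dec y l) as [Hy|Hy].
    - assert (X := valley_dec H l r H_cont V x y xy Hy). lra.
    - specialize (neg y). specialize (pl x xl). lra. }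
  assert (X := valley_inc_le y z ltac:(easy) yz). lra.
Qed.

(** Quasiconvexity at the positive level H x: going right from x, H stays below this level until the
    right branch crosses it. *)
Lemma valley_between (x y z : R) : x < l -> H y <= H x -> x <= z <= y -> H z <= H x.
Proof.
  intros xl Hxy Hz. generalize V; intros [lr [dec [pl [neg [inc pr]]]]].
  destruct (Rle_dec z l) as [Hzl|Hzl].
  - apply (valley_dec_le H l r); easy.
  - destruct (Rlt_dec z r) as [Hzr|Hzr].
    + specialize (neg z). specialize (pl x xl). lra.
    + assert (X := valley_inc_le z y ltac:(lra) ltac:(easy)). lra.
Qed.
End ValleyRight.

Lemma valley_min (H : R -> R) (l r x : R) :
  (forall x, continuous H x) -> valley H l r -> l = r -> H l <= H x.
Proof.
  intros Hc V lr. destruct (Rle_dec x l) as [Hx|Hx].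
  - now apply (valley_dec_le H l r).
  - apply (valley_inc_le H l r); [easy|easy|lra|lra].
Qed.

(* The lowest level at which the two outer branches of the valleys can be matched in
   the right order; one of the three alternatives excludes it as a solution. *)
Lemma base_level (H1 H2 : R -> R) (l1 r1 l2 r2 : R) :
  (forall x, continuous H1 x) -> (forall x, continuous H2 x) ->
  valley H1 l1 r1 -> valley H2 l2 r2 ->
  is_lim H1 m_infty p_infty -> is_lim H2 p_infty p_infty ->
  exists x0 y0 v, x0 <= l1 /\ r2 <= y0 /\ x0 <= y0 /\ H1 x0 = v /\ H2 y0 = v /\
    (v = 0 \/ (forall z, x0 <= z <= y0 -> v <= H1 z) \/
     (forall z, x0 <= z <= y0 -> v <= H2 z)).
Proof.
  intros C1 C2 V1 V2 L1 L2.
  assert (C12 : forall x, continuous (fun x => H1 x - H2 x) x)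
    by (intros x; now apply (continuous_minus H1 H2)).
  (* Overlapping outer branches: the two functions meet at one point, which serves as both x0 and
     y0, and the minimality alternative is trivial on it. *)
  assert (cross : forall u v, r2 <= u -> u <= v -> v <= l1 ->
    H1 v - H2 v <= 0 <= H1 u - H2 u ->
    exists x0 y0 v, x0 <= l1 /\ r2 <= y0 /\ x0 <= y0 /\ H1 x0 = v /\ H2 y0 = v /\
    (v = 0 \/ (forall z, x0 <= z <= y0 -> v <= H1 z) \/
     (forall z, x0 <= z <= y0 -> v <= H2 z))).
  { intros u v Hu uv Hv Hs.
    destruct (crossing (fun x => H1 x - H2 x) u v C12 uv Hs) as [x [Hx E]].
    exists x, x, (H1 x). repeat split; try lra. right; left.
    intros z Hz. replace z with x by lra. lra. }
  assert (N1 := valley_left_nonneg H1 l1 r1 C1 V1).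
  destruct (Rle_dec (H2 r2) (H1 l1)) as [Hle|Hgt].
  - destruct (valley_right_level H2 r2 C2 (H1 l1) L2 Hle) as [y1 [Hy1 E1]].
    destruct (Rle_dec l1 y1) as [Hly|Hly].
    + exists l1, y1, (H1 l1). repeat split; try lra.
      (* A positive value at [l1] collapses the middle interval, so [l1] is a global minimum of
         [H1]. *)
      destruct (Req_dec (H1 l1) 0) as [|Hne]; [now left|right; left].
      intros z _. apply (valley_min H1 l1 r1); auto.
      apply (valley_left_pos H1); auto. lra.
    + apply (cross y1 l1); try lra.
      assert (X := valley_inc_le H2 l2 r2 C2 V2 y1 l1 Hy1 ltac:(lra)).
      assert (Y := valley_dec_le H1 l1 r1 C1 V1 y1 l1 ltac:(lra) ltac:(lra)). lra.
  - destruct (valley_level H1 l1 C1 (H2 r2) L1 ltac:(lra)) as [x1 [Hx1 E1]].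
    destruct (Rle_dec x1 r2) as [Hxr|Hxr].
    + exists x1, r2, (H2 r2). repeat split; try lra. right; right.
      assert (E := valley_right_pos H2 l2 r2 C2 V2 ltac:(lra)).
      intros z _. rewrite <- E at 1. now apply (valley_min H2 l2 r2).
    + apply (cross r2 x1); try lra.
      assert (X := valley_inc_le H2 l2 r2 C2 V2 r2 x1 ltac:(lra) ltac:(lra)).
      assert (Y := valley_dec_le H1 l1 r1 C1 V1 r2 x1 ltac:(lra) ltac:(lra)). lra.
Qed.

(** * The Sturm-Liouville problem *)

Section SturmLiouville.
Variables (b sigma h : R -> R) (theta : R).
Hypothesis b_cont : forall x, continuous b x.
Hypothesis sigma_cont : forall x, continuous sigma x.
Hypothesis sigma_pos : forall x, 0 < sigma x ^ 2.
Hypothesis h_cont : forall x, continuous h x.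
Hypothesis theta_pos : 0 < theta.

Lemma q_pos (x : R) : 0 < q b sigma x.
Proof. apply exp_pos. Qed.

Lemma q_derive (x : R) :
  is_derive (q b sigma) x (2 * b x / sigma x ^ 2 * q b sigma x).
Proof.
  apply (is_derive_comp exp (fun y => RInt (fun t => 2 * b t / sigma t ^ 2) 0 y)).
  - apply is_derive_exp.
  - apply (is_derive_RInt_cont (fun t => 2 * b t / sigma t ^ 2)). intros t.
    cont. specialize (sigma_pos t). lra.
Qed.

Lemma q_cont (x : R) : continuous (q b sigma) x.
Proof. exact (is_derive_cont _ _ _ (q_derive x)). Qed.

(* With [P = q u'] the equation reads u' = P / q, P' = [weight] (lambda - h) u. *)
Definition inv_q (x : R) : R := / q b sigma x.
Definition weight (x : R) : R := 2 * theta / sigma x ^ 2 * q b sigma x.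
(** The level [V] is a function because the existence proof uses one that varies with x; eigenvalue
    problems take it constant. *)
Definition potential (V : R -> R) (x : R) : R := weight x * (V x - h x).

Lemma inv_q_pos (x : R) : 0 < inv_q x.
Proof. apply Rinv_0_lt_compat, q_pos. Qed.

Lemma inv_q_cont (x : R) : continuous inv_q x.
Proof.
  apply (continuous_comp (q b sigma) Rinv); [apply q_cont|apply continuous_Rinv].
  assert (X := q_pos x). lra.
Qed.

Lemma weight_gt_0 (x : R) : 0 < weight x.
Proof.
  apply Rmult_lt_0_compat; [|apply q_pos]. apply Rdiv_lt_0_compat; [lra|easy].
Qed.

Lemma weight_cont (x : R) : continuous weight x.
Proof.
  assert (X := q_cont x). unfold weight. cont. specialize (sigma_pos x). lra.
Qed.

Lemma potential_cont (V : R -> R) :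
  (forall x, continuous V x) -> forall x, continuous (potential V) x.
Proof.
  intros HV x. apply (continuous_mult weight (fun y => V y - h y)); [apply weight_cont|].
  now apply (continuous_minus V h).
Qed.

Lemma potential_lip (V V' : R -> R) (x d M : R) :
  Rabs (weight x) <= M -> Rabs (V x - V' x) <= d ->
  Rabs (potential V x - potential V' x) <= M * d.
Proof.
  intros HM Hd. unfold potential.
  replace (weight x * (V x - h x) - weight x * (V' x - h x))
    with (weight x * (V x - V' x)) by ring.
  rewrite Rabs_mult. apply Rmult_le_compat; auto using Rabs_pos.
Qed.

(* The value of lambda for which the candidate [g] for w_x, with derivative [dg],
   solves the Riccati equation at [x]. *)
Definition riccati (g dg : R -> R) (x : R) : R :=
  1 / 2 * theta * sigma x ^ 2 * g x ^ 2 + 1 / 2 * sigma x ^ 2 * dg x + b x * g x + h x.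

(** For U > 0 this has the sign of w_x - g. It vanishes for g = -k_+ at alpha and g = k_- at beta
    exactly when the boundary conditions hold. *)
Definition robin_gap (U P g : R -> R) (x : R) : R := P x - theta * q b sigma x * g x * U x.

Lemma gap_scal (U P g : R -> R) (k x : R) :
  robin_gap (fun t => k * U t) (fun t => k * P t) g x = k * robin_gap U P g x.
Proof. unfold robin_gap. ring. Qed.

Section Candidate.
Variables (g dg V : R -> R) (x y : R) (U P : R -> R).
Hypothesis g_derive : forall t, is_derive g t (dg t).
Hypothesis US : sol inv_q (potential V) x y U P.
Hypothesis xy : x <= y.

Let s t := theta * q b sigma t * g t.
Let ds t := theta * (2 * b t / sigma t ^ 2 * q b sigma t) * g t + theta * q b sigma t * dg t.

Lemma candidate_derive (t : R) : is_derive s t (ds t).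
Proof.
  assert (Hq := q_derive t). assert (Hg := g_derive t). unfold s, ds.
  auto_derive.
  - repeat split; eexists; eassumption.
  - derive_rw Hg.
    replace (Derive (fun z => q b sigma z) t) with (2 * b t / sigma t ^ 2 * q b sigma t)
      by (symmetry; exact (is_derive_unique _ _ _ Hq)). ring.
Qed.

(** Links the abstract barriers to the problem: [g] is a lower or an upper barrier according to
    whether the level is above or below its Riccati level. *)
Lemma candidate_defect (t : R) :
  defect inv_q (potential V) s ds t = weight t * (V t - riccati g dg t).
Proof.
  unfold defect, potential, weight, s, ds, riccati, inv_q.
  assert (X := q_pos t). assert (Y : sigma t <> 0).
  { intros E. specialize (sigma_pos t). rewrite E in sigma_pos. lra. }
  field. repeat split; try easy; lra.
Qed.

Lemma gap_sub :
  (forall t, x <= t <= y -> riccati g dg t <= V t) ->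
  (forall t, x <= t <= y -> 0 < U t) ->
  exists k, 0 < k /\ robin_gap U P g x <= k * robin_gap U P g y.
Proof.
  intros H Up. apply (barrier_sub inv_q (potential V) s ds); auto using inv_q_cont, candidate_derive.
  intros t Ht. rewrite candidate_defect. specialize (H t Ht). specialize (Up t Ht).
  assert (X := weight_gt_0 t). apply Rmult_le_pos; [apply Rmult_le_pos|]; lra.
Qed.

Lemma gap_super :
  (forall t, x <= t <= y -> V t <= riccati g dg t) ->
  (forall t, x <= t <= y -> 0 < U t) ->
  exists k, 0 < k /\ k * robin_gap U P g y <= robin_gap U P g x.
Proof.
  intros H Up. apply (barrier_super inv_q (potential V) s ds); auto using inv_q_cont, candidate_derive.
  intros t Ht. rewrite candidate_defect. specialize (H t Ht). specialize (Up t Ht).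
  assert (X := weight_gt_0 t).
  assert (0 <= weight t * (riccati g dg t - V t) * U t);
    [apply Rmult_le_pos; [apply Rmult_le_pos|]; lra|lra].
Qed.

(** Supplies the high end of a shooting argument, where positivity of [U] must be proved along with
    the sign of the gap. *)
Lemma gap_pos :
  (forall t, x <= t <= y -> riccati g dg t <= V t) ->
  0 < U x -> 0 <= robin_gap U P g x ->
  (forall t, x <= t <= y -> 0 < U t) /\ 0 <= robin_gap U P g y.
Proof.
  intros H Ux Gx.
  assert (Up : forall t, x <= t <= y -> 0 < U t).
  { apply (barrier_pos inv_q (potential V) s ds x y U P); auto using inv_q_cont, candidate_derive.
    - intros t. apply Rlt_le, inv_q_pos.
    - intros t Ht. rewrite candidate_defect. specialize (H t Ht).
      assert (X := weight_gt_0 t). apply Rmult_le_pos; lra. }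
  split; [easy|]. destruct (gap_sub H Up) as [k [Hk E]]. nra.
Qed.
End Candidate.

Lemma potential_ext (V V' : R -> R) (x y : R) (U P : R -> R) :
  (forall t, x <= t <= y -> V t = V' t) ->
  sol inv_q (potential V) x y U P -> sol inv_q (potential V') x y U P.
Proof.
  intros E S t Ht. destruct (S t Ht) as [HU HP]. split; [easy|].
  unfold potential in *. now rewrite <- E.
Qed.

(** Affine interpolation of prescribed end slopes; compactness bounds its Riccati level, so it is a
    barrier for all levels beyond [M] in absolute value. *)
Lemma linear_barrier (x y gx gy : R) :
  x < y -> exists g dg, (forall t, is_derive g t (dg t)) /\ g x = gx /\ g y = gy /\
    exists M, 0 < M /\ forall t, x <= t <= y -> Rabs (riccati g dg t) <= M.
Proof.
  intros xy. set (k := (gy - gx) / (y - x)).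
  exists (fun t => gx + k * (t - x)), (fun _ => k).
  assert (D : forall t, is_derive (fun t => gx + k * (t - x)) t k).
  { intros t. auto_derive; [easy|ring]. }
  split; [exact D|]. split; [simpl; ring|]. split; [simpl; unfold k; field; lra|].
  apply continuous_bounded. intros t _.
  assert (Gc := is_derive_cont _ _ _ (D t)). unfold riccati. cont.
Qed.


(** Existence of a principal eigenvalue by shooting between -M and M, where the affine barrier
    joining the two Robin slopes forces opposite signs of the gap at y. *)
Lemma fixed_interval_positive (x y gx gy : R) :
  x < y -> exists l U P, sol inv_q (potential (fun _ => l)) x y U P /\
    (forall t, x <= t <= y -> 0 < U t) /\ robin_gap U P (fun _ => gx) x = 0 /\
    robin_gap U P (fun _ => gy) y = 0.
Proof.
  intros xy.
  destruct (linear_barrier x y gx gy xy) as [g [dg [Dg [Ex [Ey [M [HM HgM]]]]]]].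
  destruct (continuous_bounded weight x y) as [W [HW HwW]]; [auto using weight_cont|].
  assert (Rb : forall t, x <= t <= y -> - M <= riccati g dg t <= M)
    by (intros t Ht; now apply Rabs_le_between, HgM).
  destruct (shooting inv_q (fun l => potential (fun _ => l)) x y
    (theta * q b sigma x * gx) (theta * q b sigma y * gy) (- M) M W)
    as [l [U [P [Hl [S [Ux [Px [Up Py]]]]]]]].
  - easy.
  - lra.
  - apply inv_q_cont.
  - apply inv_q_pos.
  - intros l. apply potential_cont. intros; apply continuous_const.
  - lra.
  - intros l l' t Ht. apply potential_lip; [auto|lra].
  - intros U P S Ux Px Up.
    destruct (gap_super g dg (fun _ => - M) x y U P Dg S) as [k [Hk E]]; auto; [lra| |].
    { intros t Ht. now apply Rb. }
    unfold robin_gap in E. rewrite Ex, Ey, Ux, Px in E.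
    assert (P y - theta * q b sigma y * gy * U y <= 0); [|lra].
    apply (Rmult_le_reg_l k); lra.
  - intros U P S Ux Px.
    destruct (gap_pos g dg (fun _ => M) x y U P Dg S) as [Up E]; auto; [lra| |lra| |].
    { intros t Ht. now apply Rb. }
    { unfold robin_gap. rewrite Ex, Ux, Px. lra. }
    split; [easy|]. unfold robin_gap in E. rewrite Ey in E. lra.
  - exists l, U, P. split; [easy|]. split; [easy|]. unfold robin_gap.
    rewrite Ux, Px, Py. split; ring.
Qed.

(** * The maximal eigenvalue on a fixed interval *)

Section Eigenvalues.
Variables (kp km : R -> R) (alpha beta : R).
Hypothesis alpha_beta : alpha < beta.

Lemma sol_eigenfunction (l : R) (U P : R -> R) :
  sol inv_q (potential (fun _ => l)) alpha beta U P ->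
  (exists x, alpha <= x <= beta /\ U x <> 0) ->
  robin_gap U P (fun x => - kp x) alpha = 0 -> robin_gap U P km beta = 0 ->
  is_eigenfunction b sigma h kp km alpha beta theta l U.
Proof.
  intros S NZ Ga Gb. split; [easy|].
  exists (fun x => inv_q x * P x), (fun x => potential (fun _ => l) x * U x).
  unfold robin_gap in Ga, Gb.
  split; [|split].
  - intros x Hx. destruct (S x Hx) as [HU HP]. split; [|split].
    + now apply is_derive_D_in.
    + apply is_derive_D_in, (is_derive_Rext P); [|easy].
      intros t. unfold inv_q. assert (X := q_pos t). field. lra.
    + unfold potential, weight. ring.
  - replace (P alpha) with (theta * q b sigma alpha * - kp alpha * U alpha) by lra.
    unfold inv_q. assert (X := q_pos alpha). field. lra.
  - replace (P beta) with (theta * q b sigma beta * km beta * U beta) by lra.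
    unfold inv_q. assert (X := q_pos beta). field. lra.
Qed.

Lemma eigenfunction_sol (l : R) (u : R -> R) :
  is_eigenfunction b sigma h kp km alpha beta theta l u ->
  exists U P, (forall x, alpha <= x <= beta -> U x = u x) /\
    sol inv_q (potential (fun _ => l)) alpha beta U P /\
    robin_gap U P (fun x => - kp x) alpha = 0 /\ robin_gap U P km beta = 0.
Proof.
  intros [_ [u' [qu [H [Ba Bb]]]]].
  destruct (D_in_extend u u' alpha beta) as [U [EU DU]]; [intros x Hx; now apply H|].
  destruct (D_in_extend (fun y => q b sigma y * u' y) qu alpha beta) as [P [EP DP]];
    [intros x Hx; now apply H|].
  exists U, P. split; [easy|]. split; [|split].
  - intros x Hx. destruct (H x Hx) as [_ [_ E]]. split.
    + replace (inv_q x * P x) with (u' x); [now apply DU|].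
      rewrite EP by easy. unfold inv_q. assert (X := q_pos x). field. lra.
    + replace (potential (fun _ => l) x * U x) with (qu x); [now apply DP|].
      rewrite EU by easy. unfold potential, weight. lra.
  - unfold robin_gap. rewrite EU, EP by lra.
    replace (u' alpha) with (- (theta * kp alpha * u alpha)) by lra. ring.
  - unfold robin_gap. rewrite EU, EP by lra.
    replace (u' beta) with (theta * km beta * u beta) by lra. ring.
Qed.

Lemma positive_sol_Lambda (l : R) (U P : R -> R) :
  sol inv_q (potential (fun _ => l)) alpha beta U P ->
  (forall x, alpha <= x <= beta -> 0 < U x) ->
  robin_gap U P (fun x => - kp x) alpha = 0 -> robin_gap U P km beta = 0 ->
  is_Lambda b sigma h kp km alpha beta theta l.
Proof.
  intros S Up Ga Gb. split.
  - exists U. apply (sol_eigenfunction l U P); auto.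
    exists alpha. specialize (Up alpha). split; lra.
  - intros mu [v Hv]. destruct (Rle_dec mu l) as [|Hgt]; [easy|exfalso].
    assert (NZ := proj1 Hv). destruct NZ as [x [Hx Hne]].
    destruct (eigenfunction_sol mu v Hv) as [V [Q [EV [SV [Va Vb]]]]].
    apply Hne. rewrite <- EV by easy. unfold robin_gap in *.
    apply (positive_sol_maximal inv_q (potential (fun _ => l)) (potential (fun _ => mu))
      alpha beta (theta * q b sigma alpha * - kp alpha) (theta * q b sigma beta * km beta)
      U P V Q); auto; try lra.
    + intros t. apply Rlt_le, inv_q_pos.
    + intros t _. unfold potential. assert (X := weight_gt_0 t).
      apply Rmult_lt_compat_l; lra.
Qed.

(** [is_Lambda] says nothing about signs. Shooting yields some eigenvalue with a positive
    eigenfunction; it is maximal too, hence equal to [l]. *)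
Lemma Lambda_positive_sol (l : R) :
  is_Lambda b sigma h kp km alpha beta theta l ->
  exists U P, sol inv_q (potential (fun _ => l)) alpha beta U P /\
    (forall x, alpha <= x <= beta -> 0 < U x) /\
    robin_gap U P (fun x => - kp x) alpha = 0 /\ robin_gap U P km beta = 0.
Proof.
  intros [El Ml].
  destruct (fixed_interval_positive alpha beta (- kp alpha) (km beta) alpha_beta)
    as [mu [U [P [S [Up [Ga Gb]]]]]].
  destruct (positive_sol_Lambda mu U P S Up Ga Gb) as [Emu Mmu].
  assert (mu = l) as <- by (apply Rle_antisym; auto).
  now exists U, P.
Qed.

Lemma normalised_eigenfunction_exists (l : R) :
  is_Lambda b sigma h kp km alpha beta theta l ->
  exists phi, is_phi b sigma h kp km alpha beta theta phi.
Proof.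
  intros Hl. destruct (Lambda_positive_sol l Hl) as [U [P [S [Up [Ga Gb]]]]].
  set (f := fun y => 2 * theta * q b sigma y / sigma y ^ 2 * U y ^ 2).
  assert (Cf : forall x, alpha <= x <= beta -> continuous f x).
  { intros x Hx. destruct (S x Hx) as [HU _]. apply is_derive_cont in HU.
    assert (X := q_cont x). unfold f.
    apply continuous_Rmult; [cont; specialize (sigma_pos x); lra|].
    now apply continuous_Rpow2. }
  assert (N : 0 < RInt f alpha beta).
  { apply RInt_gt_0; [easy| |easy]. intros x Hx. unfold f.
    assert (X := q_pos x). specialize (Up x ltac:(lra)).
    apply Rmult_lt_0_compat; [|now apply pow_lt].
    apply Rdiv_lt_0_compat; [|easy]. apply Rmult_lt_0_compat; lra. }
  set (k := / sqrt (RInt f alpha beta)).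
  assert (Hk : 0 < k) by now apply Rinv_0_lt_compat, sqrt_lt_R0.
  assert (Hk2 : k ^ 2 * RInt f alpha beta = 1).
  { unfold k. rewrite pow_inv, pow2_sqrt by lra. field. lra. }
  exists (fun x => k * U x). split; [|split].
  - exists l. split; [easy|]. apply (sol_eigenfunction l _ (fun x => k * P x)).
    + intros x Hx. destruct (S x Hx) as [HU HP]. split.
      * replace (inv_q x * (k * P x)) with (k * (inv_q x * P x)) by ring.
        now apply (is_derive_scal U).
      * replace (potential (fun _ => l) x * (k * U x))
          with (k * (potential (fun _ => l) x * U x)) by ring.
        now apply (is_derive_scal P).
    + exists alpha. split; [lra|]. specialize (Up alpha ltac:(lra)).
      apply Rgt_not_eq. now apply Rmult_lt_0_compat.
    + rewrite gap_scal, Ga. ring.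
    + rewrite gap_scal, Gb. ring.
  - intros x Hx. apply Rmult_lt_0_compat; auto.
  - rewrite <- Hk2.
    apply (is_RInt_ext (fun y => scal (k ^ 2) (f y))).
    + intros x _. change (k ^ 2 * f x = 2 * theta * q b sigma x / sigma x ^ 2 * (k * U x) ^ 2).
      unfold f, Rdiv. ring.
    + apply (is_RInt_scal f), (RInt_correct (V := R_CompleteNormedModule)).
      apply (ex_RInt_continuous f). rewrite Rmin_left, Rmax_right by lra. auto.
Qed.
End Eigenvalues.
End SturmLiouville.

(** * The free boundary problem *)

Definition glue (a : R) (f1 f2 : R -> R) (x : R) : R :=
  if Rle_dec x a then f1 x else f2 x.

Lemma glue_left (a : R) (f1 f2 : R -> R) (x : R) : x <= a -> glue a f1 f2 x = f1 x.
Proof. intros H. unfold glue. destruct (Rle_dec x a); easy. Qed.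

Lemma glue_right (a : R) (f1 f2 : R -> R) (x : R) :
  f1 a = f2 a -> a <= x -> glue a f1 f2 x = f2 x.
Proof.
  intros E H. unfold glue. destruct (Rle_dec x a); [|easy]. now replace x with a by lra.
Qed.

Lemma glue_derive (a : R) (f1 f2 : R -> R) (x d : R) :
  f1 a = f2 a -> (x <= a -> is_derive f1 x d) -> (a <= x -> is_derive f2 x d) ->
  is_derive (glue a f1 f2) x d.
Proof.
  intros E H1 H2. apply is_derive_Reals. intros eps He.
  assert (D1 : exists d1, 0 < d1 /\ forall t, t <> 0 -> Rabs t < d1 -> x + t <= a ->
    Rabs ((f1 (x + t) - glue a f1 f2 x) / t - d) < eps).
  { destruct (Rle_dec x a) as [Hx|Hx].
    - destruct (proj1 (is_derive_Reals f1 x d) (H1 Hx) eps He) as [d1 Hd].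
      exists d1. split; [apply cond_pos|]. intros t Ht Hs _. rewrite glue_left; auto.
    - exists (x - a). split; [lra|]. intros t Ht Hs Hle. exfalso.
      apply Rabs_def2 in Hs. lra. }
  assert (D2 : exists d2, 0 < d2 /\ forall t, t <> 0 -> Rabs t < d2 -> a <= x + t ->
    Rabs ((f2 (x + t) - glue a f1 f2 x) / t - d) < eps).
  { destruct (Rle_dec a x) as [Hx|Hx].
    - destruct (proj1 (is_derive_Reals f2 x d) (H2 Hx) eps He) as [d2 Hd].
      exists d2. split; [apply cond_pos|]. intros t Ht Hs _. rewrite glue_right; auto.
    - exists (a - x). split; [lra|]. intros t Ht Hs Hle. exfalso.
      apply Rabs_def2 in Hs. lra. }
  destruct D1 as [d1 [P1 D1]]. destruct D2 as [d2 [P2 D2]].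
  assert (Hm : 0 < Rmin d1 d2) by now apply Rmin_glb_lt.
  exists (mkposreal _ Hm). intros t Ht Hs. simpl in Hs.
  assert (M1 := Rmin_l d1 d2). assert (M2 := Rmin_r d1 d2).
  destruct (Rle_dec (x + t) a) as [Hxa|Hxa].
  - rewrite (glue_left a f1 f2 (x + t)) by easy. apply D1; auto; lra.
  - rewrite (glue_right a f1 f2 (x + t)) by (auto; lra). apply D2; auto; lra.
Qed.

(** The glued function is f1(min(y, a)) + f2(max(y, a)) - f1(a), a sum of continuous functions in
    which each piece is evaluated only on its own side. *)
Lemma glue_continuous (a : R) (f1 f2 : R -> R) (x : R) :
  f1 a = f2 a -> (x <= a -> continuous f1 x) -> (a <= x -> continuous f2 x) ->
  continuous (glue a f1 f2) x.
Proof.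
  intros E H1 H2.
  assert (L1 : continuous (fun y => f1 (Rmin y a)) x).
  { destruct (Rle_dec x a) as [Hx|Hx].
    - apply (continuous_comp (fun y => Rmin y a) f1).
      + apply continuous_Rmin_comp; [apply continuous_id|apply continuous_const].
      + rewrite Rmin_left by easy. auto.
    - apply (continuous_ext_loc _ (fun _ => f1 a)); [|apply continuous_const].
      apply (filter_imp (fun y => a < y)); [|apply open_gt; lra].
      intros y Hy. rewrite Rmin_right; [easy|lra]. }
  assert (L2 : continuous (fun y => f2 (Rmax y a)) x).
  { destruct (Rle_dec a x) as [Hx|Hx].
    - apply (continuous_comp (fun y => Rmax y a) f2).
      + apply continuous_Rmax_comp; [apply continuous_id|apply continuous_const].
      + rewrite Rmax_left by easy. auto.
    - apply (continuous_ext_loc _ (fun _ => f2 a)); [|apply continuous_const].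
      apply (filter_imp (fun y => y < a)); [|apply open_lt; lra].
      intros y Hy. rewrite Rmax_right; [easy|lra]. }
  apply (continuous_ext (fun y => f1 (Rmin y a) + f2 (Rmax y a) - f1 a)).
  - intros y. unfold glue, Rmin, Rmax. destruct (Rle_dec y a); lra.
  - apply continuous_Rminus; [now apply continuous_Rplus|apply continuous_const].
Qed.

Lemma Rmin3_eq_0 (x y z : R) :
  0 <= x -> 0 <= y -> 0 <= z -> x = 0 \/ y = 0 \/ z = 0 -> Rmin x (Rmin y z) = 0.
Proof.
  intros Hx Hy Hz H. unfold Rmin at 2. destruct (Rle_dec y z); unfold Rmin;
    destruct (Rle_dec x _); lra.
Qed.

Section FreeBoundary.
Variables (b sigma h kp km : R -> R) (theta am ap bm bp : R).
Hypothesis b_cont : forall x, continuous b x.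
Hypothesis sigma_cont : forall x, continuous sigma x.
Hypothesis sigma_pos : forall x, 0 < sigma x ^ 2.
Hypothesis h_cont : forall x, continuous h x.
Hypothesis h_nonneg : forall x, 0 <= h x.
Hypothesis theta_pos : 0 < theta.
Hypothesis kp_derive : forall x, is_derive kp x (Derive kp x).
Hypothesis km_derive : forall x, is_derive km x (Derive km x).
Hypothesis kp_cont : forall x, continuous kp x.
Hypothesis km_cont : forall x, continuous km x.
Hypothesis dkp_cont : forall x, continuous (Derive kp) x.
Hypothesis dkm_cont : forall x, continuous (Derive km) x.
Hypothesis kp_pos : forall x, 0 < kp x.
Hypothesis km_pos : forall x, 0 < km x.

Let Hm := H_minus b sigma h kp theta.
Let Hp := H_plus b sigma h km theta.
Let rq := inv_q b sigma.
Let pot := potential b sigma h theta.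
Let gap := robin_gap b sigma theta.
Let ric := riccati b sigma h theta.
Let nkp x := - kp x.
Let dnkp x := - Derive kp x.

Hypothesis Hm_valley : valley Hm am ap.
Hypothesis Hp_valley : valley Hp bm bp.
Hypothesis Hm_lim : is_lim Hm m_infty p_infty.
Hypothesis Hp_lim : is_lim Hp p_infty p_infty.

Lemma nkp_derive (x : R) : is_derive nkp x (dnkp x).
Proof. apply (is_derive_opp kp), kp_derive. Qed.

Lemma ric_nkp (x : R) : ric nkp dnkp x = Hm x.
Proof. unfold ric, riccati, nkp, dnkp, Hm, H_minus. ring. Qed.

Lemma ric_km (x : R) : ric km (Derive km) x = Hp x.
Proof. unfold ric, riccati, Hp, H_plus. ring. Qed.

Lemma Hm_cont (x : R) : continuous Hm x.
Proof. unfold Hm, H_minus. cont. Qed.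

Lemma Hp_cont (x : R) : continuous Hp x.
Proof. unfold Hp, H_plus. cont. Qed.

Section Solution.
Variables (V : R -> R) (x y : R) (U P : R -> R).
Hypothesis US : sol rq (pot V) x y U P.
Hypothesis xy : x <= y.
Hypothesis Up : forall t, x <= t <= y -> 0 < U t.

Lemma gap_nkp_sub : (forall t, x <= t <= y -> Hm t <= V t) ->
  exists k, 0 < k /\ gap U P nkp x <= k * gap U P nkp y.
Proof.
  intros H. apply (gap_sub b sigma h theta) with (dg := dnkp) (V := V);
    auto using nkp_derive. intros t Ht. fold ric. rewrite ric_nkp. auto.
Qed.

Lemma gap_nkp_super : (forall t, x <= t <= y -> V t <= Hm t) ->
  exists k, 0 < k /\ k * gap U P nkp y <= gap U P nkp x.
Proof.
  intros H. apply (gap_super b sigma h theta) with (dg := dnkp) (V := V);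
    auto using nkp_derive. intros t Ht. fold ric. rewrite ric_nkp. auto.
Qed.

Lemma gap_km_sub : (forall t, x <= t <= y -> Hp t <= V t) ->
  exists k, 0 < k /\ gap U P km x <= k * gap U P km y.
Proof.
  intros H. apply (gap_sub b sigma h theta) with (dg := Derive km) (V := V);
    auto.
Qed.

Lemma gap_km_super : (forall t, x <= t <= y -> V t <= Hp t) ->
  exists k, 0 < k /\ k * gap U P km y <= gap U P km x.
Proof.
  intros H. apply (gap_super b sigma h theta) with (dg := Derive km) (V := V);
    auto.
Qed.
End Solution.

Lemma gap_diff (U P g1 g2 : R -> R) (x : R) :
  g1 x < g2 x -> 0 < U x -> gap U P g2 x < gap U P g1 x.
Proof.
  intros H Ux. unfold gap, robin_gap. assert (X := q_pos b sigma x).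
  assert (0 < theta * q b sigma x * (g2 x - g1 x) * U x); [|lra].
  repeat apply Rmult_lt_0_compat; lra.
Qed.

(** Each alternative provides an upper barrier for w_x on [x0, y0]: the constant 0, -k_+ or k_-. As
    -k_+ < 0 < k_-, a slope starting at or below -k_+ ends strictly below k_-. *)
Lemma base_level_excluded (v x0 y0 : R) (V U P : R -> R) :
  x0 <= y0 -> (v = 0 \/ (forall z, x0 <= z <= y0 -> v <= Hm z) \/
     (forall z, x0 <= z <= y0 -> v <= Hp z)) ->
  (forall t, x0 <= t <= y0 -> V t = v) ->
  sol rq (pot V) x0 y0 U P -> (forall t, x0 <= t <= y0 -> 0 < U t) ->
  gap U P nkp x0 <= 0 -> gap U P km y0 < 0.
Proof.
  intros xy Hv HV S Up G0.
  assert (Ux : 0 < U x0) by (apply Up; lra). assert (Uy : 0 < U y0) by (apply Up; lra).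
  assert (K1 := kp_pos x0). assert (K2 := km_pos x0).
  assert (K3 := kp_pos y0). assert (K4 := km_pos y0).
  destruct Hv as [->|[Hv|Hv]].
  - destruct (gap_super b sigma h theta b_cont sigma_cont sigma_pos theta_pos
      (fun _ => 0) (fun _ => 0) V x0 y0 U P) as [k [Hk E]]; auto.
    (* The Riccati level of the constant 0 is h, and h >= 0 = v. *)
    + intros t. apply is_derive_Reals, derivable_pt_lim_const.
    + intros t Ht. rewrite HV by easy. unfold riccati. specialize (h_nonneg t). lra.
    + fold gap in E.
      assert (X := gap_diff U P nkp (fun _ => 0) x0 ltac:(unfold nkp; lra) Ux).
      assert (Y := gap_diff U P (fun _ => 0) km y0 ltac:(lra) Uy).
      assert (gap U P (fun _ => 0) y0 < 0) by nra. lra.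
  - destruct (gap_nkp_super V x0 y0 U P) as [k [Hk E]]; auto.
    { intros t Ht. rewrite HV; auto. }
    assert (Y := gap_diff U P nkp km y0 ltac:(unfold nkp; lra) Uy).
    assert (gap U P nkp y0 <= 0) by nra. lra.
  - destruct (gap_km_super V x0 y0 U P) as [k [Hk E]]; auto.
    { intros t Ht. rewrite HV; auto. }
    assert (X := gap_diff U P nkp km x0 ltac:(unfold nkp; lra) Ux).
    assert (gap U P km y0 < 0) by nra. lra.
Qed.

(* Raising the level [l] to H_- on the left and to H_+ on the right makes -k_+ and k_-
   exact solutions there, so that the free boundary problem becomes a shooting problem
   in [l] on a fixed interval. *)
Definition raised (x0 y0 l x : R) : R :=
  l + Rmax 0 (Hm (Rmin x x0) - l) + Rmax 0 (Hp (Rmax x y0) - l).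

Lemma raised_cont (x0 y0 l x : R) : continuous (raised x0 y0 l) x.
Proof.
  unfold raised. apply continuous_Rplus; [apply continuous_Rplus|].
  - apply continuous_const.
  - apply continuous_Rmax_comp; [apply continuous_const|].
    apply continuous_Rminus; [|apply continuous_const].
    apply (continuous_comp (fun t => Rmin t x0) Hm); [|apply Hm_cont].
    apply continuous_Rmin_comp; [apply continuous_id|apply continuous_const].
  - apply continuous_Rmax_comp; [apply continuous_const|].
    apply continuous_Rminus; [|apply continuous_const].
    apply (continuous_comp (fun t => Rmax t y0) Hp); [|apply Hp_cont].
    apply continuous_Rmax_comp; [apply continuous_id|apply continuous_const].
Qed.

(** One unit for each of the three summands, the positive parts being 1-Lipschitz in the level. *)
Lemma raised_lip (x0 y0 l l' x : R) :
  Rabs (raised x0 y0 l x - raised x0 y0 l' x) <= 3 * Rabs (l - l').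
Proof.
  assert (pos_lip : forall u, Rabs (Rmax 0 (u - l) - Rmax 0 (u - l')) <= Rabs (l - l')).
  { intros u. unfold Rmax, Rabs.
    destruct (Rle_dec 0 (u - l)), (Rle_dec 0 (u - l')), (Rcase_abs (l - l'));
      match goal with |- context [Rcase_abs ?e] => destruct (Rcase_abs e) end; lra. }
  unfold raised. set (u := Hm _). set (v := Hp _).
  assert (X := pos_lip u). assert (Y := pos_lip v).
  set (d := l - l') in *.
  apply Rabs_le_between in X. apply Rabs_le_between in Y.
  assert (Z : - Rabs d <= d <= Rabs d) by (apply Rabs_le_between; lra).
  apply Rabs_le_between. unfold d in *. lra.
Qed.

Section Raised.
Variables (x0 y0 v l : R).
Hypothesis x0y0 : x0 <= y0.
Hypothesis Hm0 : Hm x0 = v.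
Hypothesis Hp0 : Hp y0 = v.
Hypothesis vl : v <= l.

(** Truncating the arguments at x0 and y0 freezes the H_+ excess at v - l <= 0 here, so that only
    H_- lifts the level. *)
Lemma raised_left (x : R) : x <= x0 -> l <= Hm x -> raised x0 y0 l x = Hm x.
Proof.
  intros Hx Hl. unfold raised.
  rewrite (Rmin_left x x0), (Rmax_right x y0), Hp0 by lra.
  rewrite (Rmax_right 0 (Hm x - l)), Rmax_left by lra. ring.
Qed.

Lemma raised_right (x : R) : y0 <= x -> l <= Hp x -> raised x0 y0 l x = Hp x.
Proof.
  intros Hx Hl. unfold raised.
  rewrite (Rmin_right x x0), (Rmax_left x y0), Hm0 by lra.
  rewrite (Rmax_right 0 (Hp x - l)), Rmax_left by lra. ring.
Qed.

Lemma raised_mid (x : R) :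
  (x <= x0 -> Hm x <= l) -> (y0 <= x -> Hp x <= l) -> raised x0 y0 l x = l.
Proof.
  intros H1 H2. unfold raised.
  assert (Hm (Rmin x x0) <= l).
  { unfold Rmin. destruct (Rle_dec x x0); [auto|lra]. }
  assert (Hp (Rmax x y0) <= l).
  { unfold Rmax. destruct (Rle_dec x y0); [lra|]. apply H2; lra. }
  rewrite !Rmax_left by lra. ring.
Qed.
End Raised.

Let Hm_dec := valley_dec Hm am ap Hm_cont Hm_valley.
Let Hm_dec_le := valley_dec_le Hm am ap Hm_cont Hm_valley.
Let Hp_inc := valley_inc Hp bm bp Hp_cont Hp_valley.
Let Hp_inc_le := valley_inc_le Hp bm bp Hp_cont Hp_valley.

Lemma Hm_dec_inv (x y : R) : y <= am -> Hm x < Hm y -> x <= am -> y < x.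
Proof.
  intros Hy H Hx. destruct (Rlt_dec y x) as [|N]; [easy|exfalso].
  assert (X := Hm_dec_le x y ltac:(lra) Hy). lra.
Qed.

Lemma Hp_inc_inv (x y : R) : bp <= x -> Hp x < Hp y -> bp <= y -> x < y.
Proof.
  intros Hx H Hy. destruct (Rlt_dec x y) as [|N]; [easy|exfalso].
  assert (X := Hp_inc_le y x ltac:(lra) ltac:(lra)). lra.
Qed.

(** Shooting for the raised level on a fixed interval [L, R'], followed by restriction to the part
    where the raised level equals [l]. *)
Lemma free_boundary_exists :
  exists alpha beta l U P, alpha < beta /\ alpha < am /\ bp < beta /\
    Hm alpha = l /\ Hp beta = l /\ sol rq (pot (fun _ => l)) alpha beta U P /\
    (forall t, alpha <= t <= beta -> 0 < U t) /\
    gap U P nkp alpha = 0 /\ gap U P km beta = 0.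
Proof.
  destruct (base_level Hm Hp am ap bm bp Hm_cont Hp_cont Hm_valley Hp_valley Hm_lim Hp_lim)
    as [x0 [y0 [v [Hx0 [Hy0 [xy0 [E0 [F0 excl]]]]]]]].
  assert (lev_m : forall l, v <= l -> exists x, x <= x0 /\ Hm x = l).
  { intros l Hl. apply (valley_level Hm x0 Hm_cont); [easy|lra]. }
  assert (lev_p : forall l, v <= l -> exists x, y0 <= x /\ Hp x = l).
  { intros l Hl. apply (valley_right_level Hp y0 Hp_cont); [easy|lra]. }
  (* Level v + 1 places x1 and y1 strictly outside [x0, y0], so the affine barrier has an interval
     of positive length even if x0 = y0. *)
  destruct (lev_m (v + 1)) as [x1 [Hx1 E1]]; [lra|].
  destruct (lev_p (v + 1)) as [y1 [Hy1 F1]]; [lra|].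
  assert (x10 : x1 < x0) by (apply Hm_dec_inv; lra).
  assert (y10 : y0 < y1) by (apply Hp_inc_inv; lra).
  destruct (linear_barrier b sigma h theta b_cont sigma_cont h_cont x1 y1 (nkp x1) (km y1))
    as [g [dg [Dg [gx [gy [M [HM HgM]]]]]]]; [lra|].
  (* The bound [M] makes the affine function a barrier at level [l2], and v + 2 > v + 1 places L and
     R' strictly outside [x1, y1]. *)
  set (l2 := Rmax (v + 2) M).
  assert (vl2 : v + 2 <= l2) by apply Rmax_l. assert (Ml2 : M <= l2) by apply Rmax_r.
  destruct (lev_m l2) as [L [HL EL]]; [lra|].
  destruct (lev_p l2) as [R' [HR ER]]; [lra|].
  assert (L1 : L < x1) by (apply Hm_dec_inv; lra).
  assert (R1 : y1 < R') by (apply Hp_inc_inv; lra).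
  destruct (continuous_bounded (weight b sigma theta) L R') as [W [HW HwW]];
    [auto using weight_cont|].
  destruct (shooting rq (fun l => pot (raised x0 y0 l)) L R'
    (theta * q b sigma L * nkp L) (theta * q b sigma R' * km R') v l2 (W * 3))
    as [l [U [P [Hl [S [UL [PL [Up PR]]]]]]]].
  - lra.
  - lra.
  - now apply inv_q_cont.
  - now apply inv_q_pos.
  - intros l. apply potential_cont; auto using raised_cont.
  - lra.
  - intros l l' t Ht. rewrite Rmult_assoc. apply potential_lip; auto using raised_lip.
  (* Low end: -k_+ caps the slope on [L, x0], the base level on [x0, y0], and k_- on [y0, R']. *)
  - intros U P S UL PL Up.
    assert (GL : gap U P nkp L = 0) by (unfold gap, robin_gap; rewrite UL, PL; ring).
    destruct (Rle_dec (P R') (theta * q b sigma R' * km R' * U R')) as [|N]; [easy|exfalso].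
    assert (GR : 0 < gap U P km R') by (unfold gap, robin_gap; lra).
    destruct (gap_nkp_super (raised x0 y0 v) L x0 U P) as [k [Hk K]].
    { apply (sol_sub _ _ L R'); [lra|lra|easy]. }
    { lra. }
    { intros t Ht. apply Up; lra. }
    { intros t Ht. rewrite (raised_left x0 y0 v); try lra.
      assert (X := Hm_dec_le t x0 ltac:(lra) Hx0). lra. }
    destruct (gap_km_super (raised x0 y0 v) y0 R' U P) as [k' [Hk' K']].
    { apply (sol_sub _ _ L R'); [lra|lra|easy]. }
    { lra. }
    { intros t Ht. apply Up; lra. }
    { intros t Ht. rewrite (raised_right x0 y0 v); try lra.
      assert (X := Hp_inc_le y0 t Hy0 ltac:(lra)). lra. }
    assert (gap U P km y0 < 0); [|nra].
    apply (base_level_excluded v x0 y0 (raised x0 y0 v)); auto.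
    + intros t Ht. apply (raised_mid x0 y0 v); try lra; intros Hlt;
        [replace t with x0 by lra|replace t with y0 by lra]; lra.
    + apply (sol_sub _ _ L R'); [lra|lra|easy].
    + intros t Ht. apply Up; lra.
    + nra.
  (* High end: on [L, R'] both H_- and H_+ are dominated by [l2] on the relevant branches, so the
     raised level is constant. Three lower barriers, -k_+, [g] and k_-, agree at x1 and y1 and are
     chained. *)
  - intros U P S UL PL.
    assert (GL : gap U P nkp L = 0) by (unfold gap, robin_gap; rewrite UL, PL; ring).
    assert (V2 : forall t, L <= t <= R' -> raised x0 y0 l2 t = l2).
    { intros t Ht. apply (raised_mid x0 y0 v); try lra; intros Hlt.
      - assert (X := Hm_dec_le L t ltac:(lra) ltac:(lra)). lra.
      - assert (X := Hp_inc_le t R' ltac:(lra) ltac:(lra)). lra. }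
    destruct (gap_pos b sigma h theta b_cont sigma_cont sigma_pos theta_pos
      nkp dnkp (raised x0 y0 l2) L x1 U P) as [Up1 G1]; auto using nkp_derive.
    { apply (sol_sub _ _ L R'); [lra|lra|easy]. }
    { lra. }
    { intros t Ht. fold ric. rewrite ric_nkp, V2 by lra.
      assert (X := Hm_dec_le L t ltac:(lra) ltac:(lra)). lra. }
    { lra. }
    { fold gap. lra. }
    destruct (gap_pos b sigma h theta b_cont sigma_cont sigma_pos theta_pos
      g dg (raised x0 y0 l2) x1 y1 U P) as [Up2 G2]; auto.
    { apply (sol_sub _ _ L R'); [lra|lra|easy]. }
    { lra. }
    { intros t Ht. rewrite V2 by lra. specialize (HgM t Ht).
      apply Rabs_le_between in HgM. lra. }
    { apply Up1; lra. }
    { unfold robin_gap in *. now rewrite gx. }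
    destruct (gap_pos b sigma h theta b_cont sigma_cont sigma_pos theta_pos
      km (Derive km) (raised x0 y0 l2) y1 R' U P) as [Up3 G3]; auto.
    { apply (sol_sub _ _ L R'); [lra|lra|easy]. }
    { lra. }
    { intros t Ht. fold ric. rewrite ric_km, V2 by lra.
      assert (X := Hp_inc_le t R' ltac:(lra) ltac:(lra)). lra. }
    { apply Up2; lra. }
    { unfold robin_gap in *. now rewrite <- gy. }
    split; [|unfold robin_gap in G3; lra].
    intros t Ht. destruct (Rle_dec t x1); [apply Up1; lra|].
    destruct (Rle_dec t y1); [apply Up2|apply Up3]; lra.
  - assert (GL : gap U P nkp L = 0) by (unfold gap, robin_gap; rewrite UL, PL; ring).
    assert (GR : gap U P km R' = 0) by (unfold gap, robin_gap; rewrite PR; ring).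
    (* Where the raised level equals H_-, the barrier -k_+ is both lower and upper, so a zero gap at
       L stays zero. *)
    assert (left : forall x, L <= x <= x0 -> l <= Hm x -> gap U P nkp x = 0).
    { intros x Hx Hlx.
      assert (Sx : sol rq (pot (raised x0 y0 l)) L x U P)
        by (apply (sol_sub _ _ L R'); [lra|lra|easy]).
      assert (Vx : forall t, L <= t <= x -> raised x0 y0 l t = Hm t).
      { intros t Ht. apply (raised_left x0 y0 v); try lra.
        assert (X := Hm_dec_le t x ltac:(lra) ltac:(lra)). lra. }
      destruct (gap_nkp_sub _ L x U P Sx) as [k [Hk K]]; try lra.
      { intros t Ht. apply Up; lra. }
      { intros t Ht. rewrite Vx by easy. lra. }
      destruct (gap_nkp_super _ L x U P Sx) as [k' [Hk' K']]; try lra.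
      { intros t Ht. apply Up; lra. }
      { intros t Ht. rewrite Vx by easy. lra. }
      rewrite GL in *. apply Rle_antisym; nra. }
    assert (right : forall x, y0 <= x <= R' -> l <= Hp x -> gap U P km x = 0).
    { intros x Hx Hlx.
      assert (Sx : sol rq (pot (raised x0 y0 l)) x R' U P)
        by (apply (sol_sub _ _ L R'); [lra|lra|easy]).
      assert (Vx : forall t, x <= t <= R' -> raised x0 y0 l t = Hp t).
      { intros t Ht. apply (raised_right x0 y0 v); try lra.
        assert (X := Hp_inc_le x t ltac:(lra) ltac:(lra)). lra. }
      destruct (gap_km_sub _ x R' U P Sx) as [k [Hk K]]; try lra.
      { intros t Ht. apply Up; lra. }
      { intros t Ht. rewrite Vx by easy. lra. }
      destruct (gap_km_super _ x R' U P Sx) as [k' [Hk' K']]; try lra.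
      { intros t Ht. apply Up; lra. }
      { intros t Ht. rewrite Vx by easy. lra. }
      rewrite GR, Rmult_0_r in *. lra. }
    (* At l = v the gap of k_- at y0 would be zero, by transport from R', and negative, by exclusion
       of the base level. *)
    assert (vl : v < l).
    { destruct (Req_dec v l) as [E|]; [exfalso|lra]. rewrite <- E in *.
      assert (G0 : gap U P km y0 < 0).
      { apply (base_level_excluded v x0 y0 (raised x0 y0 v)); auto.
        - intros t Ht. apply (raised_mid x0 y0 v); try lra; intros Hlt;
            [replace t with x0 by lra|replace t with y0 by lra]; lra.
        - apply (sol_sub _ _ L R'); [lra|lra|easy].
        - intros t Ht. apply Up; lra.
        - rewrite left; lra. }
      rewrite right in G0; lra. }
    destruct (lev_m l) as [al [Hal Eal]]; [lra|].
    destruct (lev_p l) as [be [Hbe Ebe]]; [lra|].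
    assert (al0 : al < x0) by (apply Hm_dec_inv; lra).
    assert (be0 : y0 < be) by (apply Hp_inc_inv; lra).
    assert (Lal : L <= al).
    { destruct (Rle_dec L al) as [|N]; [easy|exfalso].
      assert (X := Hm_dec al L ltac:(lra) ltac:(lra)). lra. }
    assert (beR : be <= R').
    { destruct (Rle_dec be R') as [|N]; [easy|exfalso].
      assert (X := Hp_inc R' be ltac:(lra) ltac:(lra)). lra. }
    exists al, be, l, U, P. split; [lra|]. split; [lra|]. split; [lra|].
    split; [easy|]. split; [easy|]. split; [|split; [|split]].
    + apply (potential_ext b sigma h theta (raised x0 y0 l)).
      * intros t Ht. apply (raised_mid x0 y0 v); try lra; intros Hlt.
        -- assert (X := Hm_dec_le al t ltac:(lra) ltac:(lra)). lra.
        -- assert (X := Hp_inc_le t be ltac:(lra) ltac:(lra)). lra.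
      * apply (sol_sub _ _ L R'); [lra|lra|easy].
    + intros t Ht. apply Up; lra.
    + apply left; lra.
    + apply right; lra.
Qed.

(** A higher level has a strictly wider interval. On the two extra pieces -k_+ and k_- are lower
    barriers, so the wider solution has slope >= -k_+ at alpha and <= k_- at beta. The Wronskian is
    then >= 0 at alpha and <= 0 at beta, although it increases strictly in between. *)
Lemma free_boundary_level_lt (alpha beta l alpha' beta' l' : R) (U P U' P' : R -> R) :
  alpha < beta -> alpha < am -> bp < beta -> Hm alpha = l -> Hp beta = l ->
  sol rq (pot (fun _ => l)) alpha beta U P -> (forall t, alpha <= t <= beta -> 0 < U t) ->
  gap U P nkp alpha = 0 -> gap U P km beta = 0 ->
  alpha' < beta' -> alpha' < am -> bp < beta' -> Hm alpha' = l' -> Hp beta' = l' ->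
  sol rq (pot (fun _ => l')) alpha' beta' U' P' ->
  (forall t, alpha' <= t <= beta' -> 0 < U' t) ->
  gap U' P' nkp alpha' = 0 -> gap U' P' km beta' = 0 -> ~ l < l'.
Proof.
  intros ab am0 bp0 Ea Eb S Up Ga Gb ab' am0' bp0' Ea' Eb' S' Up' Ga' Gb' ll.
  assert (aa : alpha' < alpha) by (apply Hm_dec_inv; lra).
  assert (bb : beta < beta') by (apply Hp_inc_inv; lra).
  destruct (gap_nkp_sub (fun _ => l') alpha' alpha U' P') as [k [Hk K]]; try lra.
  { apply (sol_sub _ _ alpha' beta'); [lra|lra|easy]. }
  { intros t Ht. apply Up'; lra. }
  { intros t Ht. rewrite <- Ea'. apply Hm_dec_le; lra. }
  destruct (gap_km_sub (fun _ => l') beta beta' U' P') as [k' [Hk' K']]; try lra.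
  { apply (sol_sub _ _ alpha' beta'); [lra|lra|easy]. }
  { intros t Ht. apply Up'; lra. }
  { intros t Ht. rewrite <- Eb'. apply Hp_inc_le; lra. }
  assert (S1 : sol rq (pot (fun _ => l')) alpha beta U' P')
    by (apply (sol_sub _ _ alpha' beta'); [lra|lra|easy]).
  assert (W := wronskian_lt rq (pot (fun _ => l)) (pot (fun _ => l')) alpha beta U P U' P'
    ab S S1 Up).
  assert (W' : P' alpha * U alpha - P alpha * U' alpha < P' beta * U beta - P beta * U' beta).
  { apply W.
    - intros t Ht. apply Up'; lra.
    - intros t _. unfold pot, potential. assert (X := weight_gt_0 b sigma theta sigma_pos theta_pos t).
      apply Rmult_lt_compat_l; lra. }
  assert (Ua := Up alpha ltac:(lra)). assert (Ub := Up beta ltac:(lra)).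
  assert (Za : 0 <= gap U' P' nkp alpha) by nra.
  assert (Zb : gap U' P' km beta <= 0) by nra.
  assert (Ia : P' alpha * U alpha - P alpha * U' alpha
    = gap U' P' nkp alpha * U alpha - gap U P nkp alpha * U' alpha)
    by (unfold gap, robin_gap; ring).
  assert (Ib : P' beta * U beta - P beta * U' beta
    = gap U' P' km beta * U beta - gap U P km beta * U' beta)
    by (unfold gap, robin_gap; ring).
  rewrite Ga in Ia. rewrite Gb in Ib. nra.
Qed.

(** * The candidate for w_x: bounds, smooth fit and the HJB equation *)

Section Candidate.
Variables (alpha beta l : R) (U P : R -> R).
Hypothesis alpha_beta : alpha < beta.
Hypothesis alpha_am : alpha < am.
Hypothesis bp_beta : bp < beta.
Hypothesis Hm_alpha : Hm alpha = l.
Hypothesis Hp_beta : Hp beta = l.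
Hypothesis US : sol rq (pot (fun _ => l)) alpha beta U P.
Hypothesis Up : forall t, alpha <= t <= beta -> 0 < U t.
Hypothesis gap_alpha : gap U P nkp alpha = 0.
Hypothesis gap_beta : gap U P km beta = 0.

(** If H_- <= l at x, then H_- <= l on all of [alpha, x] and the sign comes from alpha. Otherwise
    H_- >= l on [x, beta] and it comes back from beta, where the slope is k_- > -k_+. *)
Lemma gap_nkp_nonneg (x : R) : alpha <= x <= beta -> 0 <= gap U P nkp x.
Proof.
  intros Hx. destruct (Rle_dec (Hm x) l) as [Hle|Hgt].
  - destruct (gap_nkp_sub (fun _ => l) alpha x U P) as [k [Hk K]]; try lra.
    { apply (sol_sub _ _ alpha beta); [lra|lra|easy]. }
    { intros t Ht. apply Up; lra. }
    { intros t Ht. rewrite <- Hm_alpha.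
      apply (valley_between Hm am ap Hm_cont Hm_valley alpha x); lra. }
    nra.
  - assert (alpha <> x) by (intros ->; lra).
    destruct (gap_nkp_super (fun _ => l) x beta U P) as [k [Hk K]]; try lra.
    { apply (sol_sub _ _ alpha beta); [lra|lra|easy]. }
    { intros t Ht. apply Up; lra. }
    { intros t Ht. rewrite <- Hm_alpha.
      apply (valley_above Hm am ap Hm_cont Hm_valley alpha x); lra. }
    assert (Y := gap_diff U P nkp km beta).
    assert (K1 := kp_pos beta). assert (K2 := km_pos beta).
    specialize (Y ltac:(unfold nkp; lra) (Up beta ltac:(lra))). nra.
Qed.

Lemma gap_km_nonpos (x : R) : alpha <= x <= beta -> gap U P km x <= 0.
Proof.
  intros Hx.
  assert (Cr := continuous_reflect Hp Hp_cont).
  assert (Vr := valley_reflect Hp bm bp Hp_valley).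
  destruct (Rle_dec (Hp x) l) as [Hle|Hgt].
  - destruct (gap_km_sub (fun _ => l) x beta U P) as [k [Hk K]]; try lra.
    { apply (sol_sub _ _ alpha beta); [lra|lra|easy]. }
    { intros t Ht. apply Up; lra. }
    { intros t Ht.
      assert (X := valley_between _ _ _ Cr Vr (- beta) (- x) (- t)).
      simpl in X. rewrite !Ropp_involutive, Hp_beta in X. apply X; lra. }
    rewrite gap_beta in K. lra.
  - assert (beta <> x) by (intros <-; lra).
    destruct (gap_km_super (fun _ => l) alpha x U P) as [k [Hk K]]; try lra.
    { apply (sol_sub _ _ alpha beta); [lra|lra|easy]. }
    { intros t Ht. apply Up; lra. }
    { intros t Ht.
      assert (X := valley_above _ _ _ Cr Vr (- beta) (- x) (- t)).
      simpl in X. rewrite !Ropp_involutive, Hp_beta in X. apply X; lra. }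
    assert (Y := gap_diff U P nkp km alpha).
    assert (K1 := kp_pos alpha). assert (K2 := km_pos alpha).
    specialize (Y ltac:(unfold nkp; lra) (Up alpha ltac:(lra))). nra.
Qed.

Let g x := rq x * P x / (theta * U x).
(** The Riccati equation at level [l] solved for the derivative. *)
Let dg x := 2 / sigma x ^ 2 * (l - h x - b x * g x) - theta * g x ^ 2.

Lemma g_derive (x : R) : alpha <= x <= beta -> is_derive g x (dg x).
Proof.
  intros Hx. destruct (US x Hx) as [HU HP]. assert (Ux := Up x Hx).
  assert (Hq := q_derive b sigma b_cont sigma_cont sigma_pos x).
  assert (qx := q_pos b sigma x). assert (sx : sigma x <> 0).
  { intros E. specialize (sigma_pos x). rewrite E in sigma_pos. lra. }
  apply (is_derive_Rext (fun t => P t / (q b sigma t * (theta * U t)))).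
  { intros t. unfold g, rq, inv_q, Rdiv. rewrite !Rinv_mult. ring. }
  auto_derive.
  - repeat split; try (eexists; eassumption).
    apply Rgt_not_eq, Rmult_lt_0_compat; [easy|now apply Rmult_lt_0_compat].
  - derive_rw HU. derive_rw HP.
    replace (Derive (fun z => q b sigma z) x) with (2 * b x / sigma x ^ 2 * q b sigma x)
      by (symmetry; exact (is_derive_unique _ _ _ Hq)).
    unfold dg, g, pot, potential, weight, rq, inv_q. field. repeat split; lra.
Qed.

Lemma g_riccati (x : R) : ric g dg x = l.
Proof.
  assert (sx : sigma x <> 0).
  { intros E. specialize (sigma_pos x). rewrite E in sigma_pos. lra. }
  unfold ric, riccati, dg. field. easy.
Qed.

Lemma gap_g (k : R -> R) (x : R) : alpha <= x <= beta ->
  gap U P k x = theta * q b sigma x * U x * (g x - k x).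
Proof.
  intros Hx. assert (Ux := Up x Hx). assert (qx := q_pos b sigma x).
  unfold gap, robin_gap, g, rq, inv_q. field. repeat split; lra.
Qed.

Lemma gap_factor_pos (x : R) : alpha <= x <= beta -> 0 < theta * q b sigma x * U x.
Proof.
  intros Hx. assert (Ux := Up x Hx). assert (qx := q_pos b sigma x).
  repeat apply Rmult_lt_0_compat; lra.
Qed.

Lemma g_alpha : g alpha = nkp alpha.
Proof.
  assert (X := gap_g nkp alpha ltac:(lra)). assert (Y := gap_factor_pos alpha ltac:(lra)).
  rewrite gap_alpha in X. nra.
Qed.

Lemma g_beta : g beta = km beta.
Proof.
  assert (X := gap_g km beta ltac:(lra)). assert (Y := gap_factor_pos beta ltac:(lra)).
  rewrite gap_beta in X. nra.
Qed.

Lemma g_bounds (x : R) : alpha <= x <= beta -> nkp x <= g x <= km x.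
Proof.
  intros Hx. assert (Y := gap_factor_pos x Hx).
  assert (X := gap_nkp_nonneg x Hx). assert (Z := gap_km_nonpos x Hx).
  rewrite gap_g in X, Z by easy. split; nra.
Qed.

(** Smooth fit: the Riccati level is affine in the derivative with coefficient sigma^2 / 2 > 0, so
    equal values and equal levels force equal derivatives. *)
Lemma riccati_derivative_unique (g1 g2 d1 d2 : R -> R) (x : R) :
  g1 x = g2 x -> ric g1 d1 x = ric g2 d2 x -> d1 x = d2 x.
Proof.
  intros E H. unfold ric, riccati in H. rewrite E in H. specialize (sigma_pos x). nra.
Qed.

Lemma dg_alpha : dnkp alpha = dg alpha.
Proof.
  apply (riccati_derivative_unique nkp g); [now rewrite g_alpha|].
  now rewrite ric_nkp, g_riccati.
Qed.

Lemma dg_beta : dg beta = Derive km beta.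
Proof.
  apply (riccati_derivative_unique g km); [apply g_beta|].
  now rewrite ric_km, g_riccati.
Qed.

Let W := glue alpha nkp (glue beta g km).
Let dW := glue alpha dnkp (glue beta dg (Derive km)).

Lemma W_alpha : nkp alpha = glue beta g km alpha.
Proof. rewrite glue_left by lra. now rewrite g_alpha. Qed.

Lemma dW_alpha : dnkp alpha = glue beta dg (Derive km) alpha.
Proof. rewrite glue_left by lra. apply dg_alpha. Qed.

Lemma W_cases (x : R) :
  (x <= alpha /\ W x = nkp x /\ dW x = dnkp x) \/
  (alpha <= x <= beta /\ W x = g x /\ dW x = dg x) \/
  (beta <= x /\ W x = km x /\ dW x = Derive km x).
Proof.
  assert (X1 := W_alpha). assert (X2 := dW_alpha).
  assert (X3 := g_beta). assert (X4 := dg_beta). unfold W, dW.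
  destruct (Rle_dec x alpha); [left|right; destruct (Rle_dec x beta); [left|right]].
  - now rewrite !glue_left.
  - rewrite !(glue_right alpha), !glue_left by (auto; lra). repeat split; lra.
  - rewrite !(glue_right alpha), !glue_right by (auto; lra). repeat split; lra.
Qed.

Lemma W_derive (x : R) : is_derive W x (dW x).
Proof.
  assert (X1 := W_alpha). assert (X2 := dW_alpha).
  assert (X3 := g_beta). assert (X4 := dg_beta). unfold W, dW.
  apply glue_derive; [easy| |].
  - intros Hx. rewrite glue_left by easy. apply nkp_derive.
  - intros Hx. rewrite glue_right by easy. apply glue_derive; [easy| |].
    + intros Hx'. rewrite glue_left by easy. now apply g_derive.
    + intros Hx'. now rewrite glue_right.
Qed.

Lemma dW_cont (x : R) : continuous dW x.
Proof.
  unfold dW. apply glue_continuous; [apply dW_alpha| |].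
  - intros _. apply (continuous_Ropp (Derive kp)), dkp_cont.
  - intros Hx. apply glue_continuous; [apply dg_beta| |].
    + intros Hx'. assert (Gc := is_derive_cont _ _ _ (g_derive x (conj Hx Hx'))).
      unfold dg. cont. specialize (sigma_pos x). lra.
    + intros _. apply dkm_cont.
Qed.

Lemma w_x_W (phi : R -> R) (x : R) :
  (forall t, alpha <= t <= beta -> U t = phi t) ->
  w_x kp km theta alpha beta phi x = W x.
Proof.
  intros E. unfold w_x, W, glue.
  destruct (Rle_dec x alpha) as [|Ha]; [easy|].
  destruct (Rlt_dec x beta) as [Hb|Hb], (Rle_dec x beta); try lra.
  - destruct (US x) as [HU _]; [lra|]. assert (Ux := Up x ltac:(lra)).
    assert (D : is_derive (fun y => ln (phi y)) x (rq x * P x / U x)).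
    { apply (is_derive_ext_loc (fun y => ln (U y))).
      - apply (filter_imp (fun y => alpha < y /\ y < beta)).
        + intros y Hy. rewrite E by lra. easy.
        + apply filter_and; [apply (open_gt alpha)|apply (open_lt beta)]; lra.
      - auto_derive; [split; [eexists; eassumption|easy]|].
        derive_rw HU. field. lra. }
    assert (D' := is_derive_unique _ _ _ D). simpl in D'. rewrite D'.
    unfold g. field. lra.
  - replace x with beta by lra. now rewrite g_beta.
Qed.

Lemma candidate_exists (phi : R -> R) :
  (forall t, alpha <= t <= beta -> U t = phi t) ->
  exists w, forall x, is_derive w x (w_x kp km theta alpha beta phi x).
Proof.
  intros E. exists (fun x => RInt W 0 x). intros x. rewrite w_x_W by easy.
  apply is_derive_RInt_cont. intros t. exact (is_derive_cont _ _ _ (W_derive t)).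
Qed.

Section HJBSolution.
Variable w : R -> R.
Hypothesis w_derive : forall x, is_derive w x (W x).

Lemma Derive_w (x : R) : Derive w x = W x.
Proof. apply is_derive_unique, w_derive. Qed.

Lemma Derive_w_derive (x : R) : is_derive (Derive w) x (dW x).
Proof. apply (is_derive_Rext W); [apply Derive_w|apply W_derive]. Qed.

Lemma Derive2_w (x : R) : Derive_n w 2 x = dW x.
Proof. apply is_derive_unique, Derive_w_derive. Qed.

Lemma w_class_C2 : class_C 2 w.
Proof.
  intros k x Hk. destruct k as [|[|[|k]]]; [| | |lia].
  - split; [easy|]. exact (is_derive_cont _ _ _ (w_derive x)).
  - split; [exists (W x); apply w_derive|].
    exact (is_derive_cont _ _ _ (Derive_w_derive x)).
  - split; [exists (dW x); apply Derive_w_derive|].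
    apply (continuous_ext dW); [intros t; now rewrite Derive2_w|apply dW_cont].
Qed.

(** In the outer regions the differential term equals H_- - l or H_+ - l, nonnegative by
    monotonicity of the branches, and one gradient constraint is tight. In the middle the
    differential term vanishes and the barriers give the gradient bounds. *)
Lemma w_HJB : HJB b sigma h kp km theta w l.
Proof.
  intros x. rewrite Derive2_w, Derive_w.
  assert (K1 := kp_pos x). assert (K2 := km_pos x).
  destruct (W_cases x) as [[Hx [-> ->]]|[[Hx [-> ->]]|[Hx [-> ->]]]].
  - assert (X := ric_nkp x). assert (Y := Hm_dec_le x alpha Hx ltac:(lra)).
    unfold ric, riccati in X. unfold nkp, dnkp in *. apply Rmin3_eq_0; lra.
  - assert (X := g_riccati x). assert (Y := g_bounds x Hx).
    unfold ric, riccati in X. unfold nkp in Y. apply Rmin3_eq_0; lra.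
  - assert (X := ric_km x). assert (Y := Hp_inc_le beta x ltac:(lra) Hx).
    unfold ric, riccati in X. apply Rmin3_eq_0; lra.
Qed.
End HJBSolution.
End Candidate.
End FreeBoundary.

Lemma class_C_derive (n : nat) (f : R -> R) (x : R) :
  class_C (S n) f -> is_derive f x (Derive f x).
Proof. intros H. apply Derive_correct. exact (proj1 (H 1%nat x ltac:(lia))). Qed.

Lemma class_C_cont (n : nat) (f : R -> R) (x : R) : class_C n f -> continuous f x.
Proof. intros H. exact (proj2 (H 0%nat x ltac:(lia))). Qed.

Theorem theorem3 (b sigma h kp km am ap bm bp : R -> R)
  (A1 : Assumption1 b sigma)
  (A2 : Assumption2 b sigma h kp km am ap bm bp) :
  (forall theta : R, 0 < theta ->
     exists! p : R * R,
       exists lambda : R,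
         free_boundary b sigma h kp km am bp theta (fst p) (snd p) lambda)
  /\
  (forall theta alpha beta lambda : R, 0 < theta ->
     free_boundary b sigma h kp km am bp theta alpha beta lambda ->
     (exists phi : R -> R, is_phi b sigma h kp km alpha beta theta phi) /\
     forall phi : R -> R, is_phi b sigma h kp km alpha beta theta phi ->
       (exists w : R -> R,
          forall x : R,
            is_derive w x (w_x kp km theta alpha beta phi x)) /\
       forall w : R -> R,
         (forall x : R,
            is_derive w x (w_x kp km theta alpha beta phi x)) ->
         class_C 2 w /\ HJB b sigma h kp km theta w lambda).
Proof.
  destruct A1 as [Cb [Csigma [C [HC HsC]]]].
  destruct A2 as [Ch [h_nonneg [Ckp [Ckm [[K [HK [kpK kmK]]] Hth]]]]].
  assert (b_cont := fun x => class_C_cont 1 b x Cb).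
  assert (sigma_cont := fun x => class_C_cont 1 sigma x Csigma).
  assert (sigma_pos := fun x => proj1 (HsC x)).
  assert (h_cont := fun x => class_C_cont 1 h x Ch).
  assert (kp_d := fun x => class_C_derive 1 kp x Ckp).
  assert (km_d := fun x => class_C_derive 1 km x Ckm).
  assert (kp_cont := fun x => class_C_cont 2 kp x Ckp).
  assert (km_cont := fun x => class_C_cont 2 km x Ckm).
  assert (dkp_cont : forall x, continuous (Derive kp) x)
    by (intros x; exact (proj2 (Ckp 1%nat x ltac:(lia)))).
  assert (dkm_cont : forall x, continuous (Derive km) x)
    by (intros x; exact (proj2 (Ckm 1%nat x ltac:(lia)))).
  assert (kp_pos := fun x => proj1 (kpK x)). assert (km_pos := fun x => proj1 (kmK x)).
  split.
  - intros theta theta_pos. destruct (Hth theta theta_pos) as [Lm [Lp [Vm Vp]]].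
    destruct (free_boundary_exists b sigma h kp km theta (am theta) (ap theta) (bm theta)
      (bp theta)) as [alpha [beta [l [U [P [ab [aam [bbp [Ea [Eb [S [Up [Ga Gb]]]]]]]]]]]]];
      auto.
    exists (alpha, beta). split.
    { exists l. simpl. repeat (split; [easy|]). split; [|easy].
      apply (positive_sol_Lambda b sigma h theta) with (U := U) (P := P); auto. }
    intros [alpha' beta'] [l' [ab' [aam' [bbp' [HL' [Ea' Eb']]]]]]. cbn [fst snd] in *.
    destruct (Lambda_positive_sol b sigma h theta b_cont sigma_cont sigma_pos h_cont theta_pos
      kp km alpha' beta' ab' l' HL') as [U' [P' [S' [Up' [Ga' Gb']]]]].
    assert (lt_excluded := free_boundary_level_lt b sigma h kp km theta (am theta) (ap theta)
      (bm theta) (bp theta) b_cont sigma_cont sigma_pos h_cont theta_pos kp_d km_d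
      kp_cont km_cont dkp_cont dkm_cont Vm Vp).
    (* Once the levels agree, strict monotonicity of H_- left of [am theta] and of H_+ right of
       [bp theta] identifies the end points. *)
    assert (l = l') as <-.
    { destruct (Rtotal_order l l') as [Hlt|[|Hgt]]; [exfalso|easy|exfalso].
      - apply (lt_excluded alpha beta l alpha' beta' l' U P U' P'); auto.
      - apply (lt_excluded alpha' beta' l' alpha beta l U' P' U P); auto. }
    f_equal.
    + destruct (Rtotal_order alpha alpha') as [Hlt|[|Hgt]]; [exfalso|easy|exfalso].
      * assert (X := proj1 (proj2 Vm) alpha alpha' Hlt aam'). lra.
      * assert (X := proj1 (proj2 Vm) alpha' alpha Hgt aam). lra.
    + destruct Vp as [_ [_ [_ [_ [inc _]]]]].
      destruct (Rtotal_order beta beta') as [Hlt|[|Hgt]]; [exfalso|easy|exfalso].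
      * assert (X := inc beta beta' bbp Hlt). lra.
      * assert (X := inc beta' beta bbp' Hgt). lra.
  - intros theta alpha beta l theta_pos [ab [aam [bbp [HL [Ea Eb]]]]].
    destruct (Hth theta theta_pos) as [Lm [Lp [Vm Vp]]].
    split; [now apply (normalised_eigenfunction_exists b sigma h theta) with (l := l)|].
    intros phi [[mu [Hmu Ephi]] [phi_pos _]].
    (* [is_phi] carries an eigenvalue of its own, which maximality identifies with [l]. *)
    assert (mu = l) as -> by (apply Rle_antisym; [apply HL, Hmu|apply Hmu, HL]).
    destruct (eigenfunction_sol b sigma h theta kp km alpha beta ab l phi Ephi)
      as [U [P [EU [S [Ga Gb]]]]].
    assert (Up : forall x, alpha <= x <= beta -> 0 < U x)
      by (intros x Hx; rewrite EU; auto).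
    split.
    + apply (candidate_exists b sigma h kp km theta) with (l := l) (U := U) (P := P); auto.
    + intros w Hw.
      split.
      * apply (w_class_C2 b sigma h kp km theta) with (alpha := alpha) (beta := beta) (l := l)
          (U := U) (P := P); auto.
        intros x. specialize (Hw x). erewrite w_x_W in Hw; eauto.
      * apply (w_HJB b sigma h kp km theta (am theta) (ap theta) (bm theta) (bp theta))
          with (alpha := alpha) (beta := beta) (U := U) (P := P); auto.
        intros x. specialize (Hw x). erewrite w_x_W in Hw; eauto.
Qed.
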